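(* Let $\mathfrak g$ be a semisimple Lie algebra over $\Bbbk$, $\vartheta\in\mathrm{Aut}(\mathfrak g)$ an automorphism of finite order $m\ge 2$, and $\tilde{\mathfrak g}=\mathfrak g_0\ltimes\mathfrak g_{(\infty)}$. Then $\mathrm{ind}\,\tilde{\mathfrak g}=\mathrm{ind}(\mathfrak g_0\oplus\mathfrak g)=\mathrm{rk}\,\mathfrak g_0+\mathrm{rk}\,\mathfrak g$.
   Context: $\Bbbk$ is an algebraically closed field of characteristic $0$. The index of a Lie algebra $\mathfrak q$ is $\mathrm{ind}\,\mathfrak q=\min_{\xi\in\mathfrak q^*}\dim\{x\in\mathfrak q\mid\xi([x,\mathfrak q])=0\}$; the rank of a reductive Lie algebra is the dimension of its Cartan subalgebra. $\zeta$ is a primitive $m$-th root of unity, $\mathfrak g_i=\{x\in\mathfrak g\mid\vartheta(x)=\zeta^ix\}$ for $0\le i\le m-1$; $\mathfrak g_0=\mathfrak g^\vartheta$ is reductive. The Lie algebra $\mathfrak g_{(\infty)}$ is the vector space $\mathfrak g$ with the bracket $[x,y]_\infty=[x,y]$ if $x\in\mathfrak g_i$, $y\in\mathfrak g_j$, $0\le i,j\le m-1$, $i+j\ge m$, and $[x,y]_\infty=0$ if $i+j\le m-1$. The Lie algebra $\mathfrak g_0$ acts on $\mathfrak g_{(\infty)}$ by derivations through the adjoint action in $\mathfrak g$, and $\tilde{\mathfrak g}=\mathfrak g_0\ltimes\mathfrak g_{(\infty)}$ is the corresponding semidirect product. *)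

(* Defs.v *)
From HB Require Import structures.
From mathcomp Require Import all_boot all_order all_algebra.
From mathcomp Require Import zify ring.
From mathcomp Require Import boolp classical_sets.

Set Implicit Arguments.
Unset Strict Implicit.
Unset Printing Implicit Defensive.

Import GRing.Theory VectorInternalTheory.
Local Open Scope ring_scope.

HB.mixin Record Vector_isLie (K : fieldType) L of Vector K L := {
  lie_bracket : L -> L -> L;
  lie_linearl : forall (a : K) (x y z : L),
    lie_bracket (a *: x + y) z = a *: lie_bracket x z + lie_bracket y z;
  lie_linearr : forall (a : K) (x y z : L),
    lie_bracket x (a *: y + z) = a *: lie_bracket x y + lie_bracket x z;
  liexx : forall x : L, lie_bracket x x = 0;
  lie_jacobi : forall x y z : L,
    lie_bracket x (lie_bracket y z) + lie_bracket y (lie_bracket z x)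
      + lie_bracket z (lie_bracket x y) = 0
}.

#[short(type="lieAlgType")]
HB.structure Definition LieAlg (K : fieldType) :=
  { L of Vector_isLie K L & Vector K L }.

Notation "[lie x , y ]" := (lie_bracket x y)
  (at level 0, x, y at level 99, format "[lie  x ,  y ]") : ring_scope.

Section BracketTheory.
Variables (K : fieldType) (L : lieAlgType K).
Implicit Types (x y z : L) (a : K).

Lemma lieDl x y z : [lie x + y, z] = [lie x, z] + [lie y, z].
Proof. by rewrite -[x]scale1r lie_linearl !scale1r. Qed.
Lemma lieDr x y z : [lie x, y + z] = [lie x, y] + [lie x, z].
Proof. by rewrite -[y]scale1r lie_linearr !scale1r. Qed.
Lemma lie0l x : [lie 0, x] = 0.
Proof. by apply: (addrI [lie 0, x]); rewrite -lieDl !addr0. Qed.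
Lemma lie0r x : [lie x, 0] = 0.
Proof. by apply: (addrI [lie x, 0]); rewrite -lieDr !addr0. Qed.
Lemma lieZl a x y : [lie a *: x, y] = a *: [lie x, y].
Proof. by rewrite -[a *: x]addr0 lie_linearl lie0l addr0. Qed.
Lemma lieZr a x y : [lie x, a *: y] = a *: [lie x, y].
Proof. by rewrite -[a *: y]addr0 lie_linearr lie0r addr0. Qed.
Lemma lieC x y : [lie x, y] = - [lie y, x].
Proof.
apply/eqP; rewrite -addr_eq0; apply/eqP.
by have := liexx (x + y); rewrite lieDl !lieDr !liexx add0r addr0.
Qed.
Lemma lieNl x y : [lie - x, y] = - [lie x, y].
Proof. by rewrite -scaleN1r lieZl scaleN1r. Qed.
Lemma lieNr x y : [lie x, - y] = - [lie x, y].
Proof. by rewrite -scaleN1r lieZr scaleN1r. Qed.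
Lemma lie_suml I (r : seq I) (P : pred I) (F : I -> L) y :
  [lie \sum_(i <- r | P i) F i, y] = \sum_(i <- r | P i) [lie F i, y].
Proof.
by elim/big_rec2: _ => [|i u v _ <-]; rewrite ?lie0l ?lieDl.
Qed.
Lemma lie_sumr I (r : seq I) (P : pred I) (F : I -> L) x :
  [lie x, \sum_(i <- r | P i) F i] = \sum_(i <- r | P i) [lie x, F i].
Proof.
by elim/big_rec2: _ => [|i u v _ <-]; rewrite ?lie0r ?lieDr.
Qed.

End BracketTheory.

Section Index.
Variables (K : fieldType) (L : lieAlgType K).

Definition lie_stab (xi : 'Hom(L, K^o)) : {vspace L} :=
  lker (linfun (fun x : L => linfun (fun y : L => xi [lie x, y]))).

Lemma lie_stabP (xi : 'Hom(L, K^o)) (x : L) :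
  reflect (forall y, xi [lie x, y] = 0) (x \in lie_stab xi).
Proof.
have linr u : linear (fun y : L => xi [lie u, y] : K^o).
  by move=> a y z; rewrite lie_linearr linearP.
pose fr u : {linear L -> K^o} :=
  HB.pack (fun y : L => xi [lie u, y] : K^o)
    (GRing.isLinear.Build K L K^o _ _ (linr u)).
have frE u : linfun (fun y : L => xi [lie u, y] : K^o) =1 fr u.
  exact: (lfunE (fr u)).
have linl : linear (fun u : L => linfun (fun y : L => xi [lie u, y] : K^o)).
  move=> a u v; apply/lfunP => y.
  by rewrite add_lfunE scale_lfunE !frE /= lie_linearl linearP.
pose fl : {linear L -> 'Hom(L, K^o)} :=
  HB.pack (fun u : L => linfun (fun y : L => xi [lie u, y] : K^o))
    (GRing.isLinear.Build K L 'Hom(L, K^o) _ _ linl).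
rewrite memv_ker (lfunE fl) /=; apply: (iffP eqP) => [/lfunP h y | h].
  by have := h y; rewrite frE zero_lfunE.
by apply/lfunP => y; rewrite frE zero_lfunE /= h.
Qed.

Fact lie_stab_dim_ex : exists n,
  `[< exists xi : 'Hom(L, K^o), \dim (lie_stab xi) = n >].
Proof. by exists (\dim (lie_stab 0)); apply/asboolP; exists 0. Qed.

Definition lie_ind : nat := ex_minn lie_stab_dim_ex.

End Index.
Arguments lie_ind {K} L.

Section Subspaces.
Variables (K : fieldType) (L : lieAlgType K).
Implicit Types U V H I : {vspace L}.

Definition lie_span U V : {vspace L} :=
  <<[seq [lie x, y] | x <- vbasis U, y <- vbasis V]>>%VS.

Lemma memv_lie_span U V x y :
  x \in U -> y \in V -> [lie x, y] \in lie_span U V.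
Proof.
move=> /coord_vbasis -> /coord_vbasis ->.
rewrite lie_suml; apply: memv_suml => i _; rewrite lie_sumr.
apply: memv_suml => j _; rewrite lieZl lieZr !memvZ // memv_span //.
by apply/allpairsP; exists ((vbasis U)`_i, (vbasis V)`_j);
  rewrite !mem_nth ?size_tuple.
Qed.

Definition lie_closed H : Prop :=
  forall x y, x \in H -> y \in H -> [lie x, y] \in H.

Definition lie_ideal I : Prop := forall x y, y \in I -> [lie x, y] \in I.

Definition lie_solvable H : Prop :=
  exists n, iter n (fun W => lie_span W W) H = 0%VS.

Definition lie_nilpotent H : Prop :=
  exists n, iter n (fun W => lie_span H W) H = 0%VS.

Definition cartan_subalgebra H : Prop :=
  [/\ lie_closed H, lie_nilpotent H
    & forall x, (forall h, h \in H -> [lie x, h] \in H) -> x \in H].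

End Subspaces.

Definition lie_semisimple (K : fieldType) (L : lieAlgType K) : Prop :=
  forall I : {vspace L}, lie_ideal I -> lie_solvable I -> I = 0%VS.

(* The dimension of a chosen Cartan subalgebra. Over an algebraically closed
   field of characteristic 0 Cartan subalgebras exist and are conjugate, so the
   default value of xget and the choice play no role. *)
Definition lie_rank (K : fieldType) (L : lieAlgType K) : nat :=
  \dim (xget 0%VS [set H : {vspace L} | cartan_subalgebra H]%classic).
Arguments lie_rank {K} L.

Record lieSubalg (K : fieldType) (L : lieAlgType K) := LieSubalg {
  lsv :> {vspace L};
  lsv_closed : lie_closed lsv }.

Section SubLie.
Variables (K : fieldType) (L : lieAlgType K) (H : lieSubalg L).
Local Notation sH := (subvs_of (lsv H)).

Definition sub_bracket (x y : sH) : sH :=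
  Subvs (lsv_closed (subvsP x) (subvsP y)).

Fact sub_linearl (a : K) (x y z : sH) :
  sub_bracket (a *: x + y) z = a *: sub_bracket x z + sub_bracket y z.
Proof. by apply: subvs_inj; rewrite /= lie_linearl. Qed.
Fact sub_linearr (a : K) (x y z : sH) :
  sub_bracket x (a *: y + z) = a *: sub_bracket x y + sub_bracket x z.
Proof. by apply: subvs_inj; rewrite /= lie_linearr. Qed.
Fact sub_liexx (x : sH) : sub_bracket x x = 0.
Proof. by apply: subvs_inj; rewrite /= liexx. Qed.
Fact sub_jacobi (x y z : sH) :
  sub_bracket x (sub_bracket y z) + sub_bracket y (sub_bracket z x)
    + sub_bracket z (sub_bracket x y) = 0.
Proof. by apply: subvs_inj; rewrite /= lie_jacobi. Qed.

HB.instance Definition _ := Vector_isLie.Build K sH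
  sub_linearl sub_linearr sub_liexx sub_jacobi.

End SubLie.

Section DirectSum.
Variables (K : fieldType) (L1 L2 : lieAlgType K).
Local Notation P := (L1 * L2)%type.

Definition prod_bracket (x y : P) : P := ([lie x.1, y.1], [lie x.2, y.2]).

Fact prod_linearl (a : K) (x y z : P) :
  prod_bracket (a *: x + y) z = a *: prod_bracket x z + prod_bracket y z.
Proof. by congr pair; rewrite /= lie_linearl. Qed.
Fact prod_linearr (a : K) (x y z : P) :
  prod_bracket x (a *: y + z) = a *: prod_bracket x y + prod_bracket x z.
Proof. by congr pair; rewrite /= lie_linearr. Qed.
Fact prod_liexx (x : P) : prod_bracket x x = 0.
Proof. by congr pair; rewrite /= liexx. Qed.
Fact prod_jacobi (x y z : P) :
  prod_bracket x (prod_bracket y z) + prod_bracket y (prod_bracket z x)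
    + prod_bracket z (prod_bracket x y) = 0.
Proof. by congr pair; rewrite /= lie_jacobi. Qed.

HB.instance Definition _ := Vector_isLie.Build K P
  prod_linearl prod_linearr prod_liexx prod_jacobi.

End DirectSum.

Record lieAction (K : fieldType) (A N : lieAlgType K) := LieAction {
  act :> A -> N -> N;
  act_linearl : forall (a : K) (s t : A) (x : N),
    act (a *: s + t) x = a *: act s x + act t x;
  act_linearr : forall (a : K) (s : A) (x y : N),
    act s (a *: x + y) = a *: act s x + act s y;
  act_lie : forall (s t : A) (x : N),
    act [lie s, t] x = act s (act t x) - act t (act s x);
  act_deriv : forall (s : A) (x y : N),
    act s [lie x, y] = [lie act s x, y] + [lie x, act s y] }.

Definition semidirect (K : fieldType) (A N : lieAlgType K)
  (rho : lieAction A N) : Type := (A * N)%type.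

Section Semidirect.
Variables (K : fieldType) (A N : lieAlgType K) (rho : lieAction A N).
Local Notation S := (semidirect rho).

HB.instance Definition _ := Vector.copy S (A * N)%type.

Definition semidirect_bracket (p q : S) : S :=
  ([lie p.1, q.1], rho p.1 q.2 - rho q.1 p.2 + [lie p.2, q.2]).

Let rhoD s x y : rho s (x + y) = rho s x + rho s y.
Proof. by rewrite -[x]scale1r act_linearr !scale1r. Qed.
Let rho0 s : rho s 0 = 0.
Proof. by apply: (addrI (rho s 0)); rewrite -rhoD !addr0. Qed.
Let rhoN s x : rho s (- x) = - rho s x.
Proof. by apply: (addrI (rho s x)); rewrite -rhoD !subrr rho0. Qed.

Fact semidirect_linearl (a : K) (p q r : S) :
  semidirect_bracket (a *: p + q) r
    = a *: semidirect_bracket p r + semidirect_bracket q r.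
Proof.
congr pair; rewrite /= ?lie_linearl //.
rewrite act_linearl act_linearr; apply: (can_inj v2rK); apply/rowP => i.
by rewrite !(linearD, linearN, linearZ) /= !mxE; ring.
Qed.
Fact semidirect_linearr (a : K) (p q r : S) :
  semidirect_bracket p (a *: q + r)
    = a *: semidirect_bracket p q + semidirect_bracket p r.
Proof.
congr pair; rewrite /= ?lie_linearr //.
rewrite act_linearl act_linearr; apply: (can_inj v2rK); apply/rowP => i.
by rewrite !(linearD, linearN, linearZ) /= !mxE; ring.
Qed.
Fact semidirect_liexx (p : S) : semidirect_bracket p p = 0.
Proof. by congr pair; rewrite /= ?subrr ?add0r liexx. Qed.
Fact semidirect_jacobi (p q r : S) :
  semidirect_bracket p (semidirect_bracket q r)
    + semidirect_bracket q (semidirect_bracket r p)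
    + semidirect_bracket r (semidirect_bracket p q) = 0.
Proof.
congr pair; rewrite /= ?lie_jacobi //.
case: p q r => [a x] [b y] [c w] /=.
rewrite !rhoD !rhoN !act_deriv !act_lie !lieDr !lieNr.
rewrite (lieC (rho a y) w) (lieC (rho b w) x) (lieC (rho c x) y).
move: (lie_jacobi x y w) => /(congr1 v2r)/rowP J.
apply: (can_inj v2rK); apply/rowP => i; have {J} := J i.
rewrite !(linearD, linearN, linear0) /= !mxE => J.
by rewrite -[RHS]J; ring.
Qed.

HB.instance Definition _ := Vector_isLie.Build K S
  semidirect_linearl semidirect_linearr semidirect_liexx semidirect_jacobi.

End Semidirect.

(* In finite dimension an injective endomorphism is bijective. *)
Record lieAut (K : fieldType) (L : lieAlgType K) := LieAut {
  lauf :> 'End(L);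
  lauf_inj : lker lauf = 0%VS;
  lauf_lie : forall x y, lauf [lie x, y] = [lie lauf x, lauf y] }.

Definition lie_aut_order (K : fieldType) (L : lieAlgType K)
    (theta : lieAut L) (m : nat) : Prop :=
  [/\ (0 < m)%N, forall x, iter m theta x = x
    & forall k, (0 < k < m)%N -> ~ (forall x, iter k theta x = x)].

Section Fixed.
Variables (K : fieldType) (L : lieAlgType K) (theta : lieAut L).

Fact fixed_closed : lie_closed (fixedSpace theta).
Proof.
move=> x y /fixedSpaceP xf /fixedSpaceP yf.
by apply/fixedSpaceP; rewrite lauf_lie xf yf.
Qed.

Definition fixed_subalg : lieSubalg L := LieSubalg fixed_closed.

End Fixed.

Section Grading.
Variables (K : fieldType) (L : lieAlgType K) (theta : lieAut L).
Variables (m : nat) (z : K).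

Definition grade (i : nat) : {vspace L} := passmx.leigenspace theta (z ^+ i).

(* For z a primitive m-th root of unity and theta ^ m = 1, the projection of L
   onto grade i along the other eigenspaces: see gradecomp_mem, gradecomp_sum
   and gradecomp_id. *)
Definition gradecomp (i : nat) (x : L) : L :=
  m%:R^-1 *: \sum_(k < m) z ^- (i * k) *: iter k theta x.

(* The sum defines the bracket on all of L; on homogeneous elements it is [x, y]
   or 0 according to the degrees: see contraction_bracketE. *)
Definition contraction_bracket (x y : L) : L :=
  \sum_(i < m) \sum_(j < m | (m <= i + j)%N)
    [lie gradecomp i x, gradecomp j y].

Lemma gradeP i x : reflect (theta x = z ^+ i *: x) (x \in grade i).
Proof.
by rewrite memv_ker add_lfunE opp_lfunE scale_lfunE id_lfunE subr_eq0;
  apply: eqP.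
Qed.

Lemma grade0 : grade 0 = fixed_subalg theta.
Proof.
by apply/vspaceP => x; apply/gradeP/fixedSpaceP; rewrite expr0 scale1r.
Qed.

Hypotheses (zP : m.-primitive_root z) (thetaP : lie_aut_order theta m).

Let m_gt0 : (0 < m)%N. Proof. by case: thetaP. Qed.
Let z_neq0 : z != 0. Proof. by rewrite (prim_root_eq0 zP) -lt0n. Qed.
Let m_neq0 : m%:R != 0 :> K. Proof. exact: prim_root_natf_neq0 zP. Qed.

Let iterP k (a : K) x y :
  iter k theta (a *: x + y) = a *: iter k theta x + iter k theta y.
Proof. by elim: k => //= k ->; rewrite linearP. Qed.

Let sum_roots i j : (i < m)%N -> (j < m)%N ->
  \sum_(k < m) z ^- (j * k) * z ^+ (i * k) = if i == j then m%:R else 0 :> K.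
Proof.
move=> ltim ltjm; pose w := z ^+ i / z ^+ j.
under eq_bigr => k _ do
  rewrite mulrC [(j * k)%N]mulnC [(i * k)%N]mulnC !(mulnC k) !exprM
    -expr_div_n -/w.
case: eqP => [eij|/eqP neij].
  under eq_bigr => k _ do rewrite /w eij divff ?expf_neq0 // expr1n.
  by rewrite sumr_const card_ord.
have w1 : w - 1 != 0.
  rewrite subr_eq0; apply: contra neij => /eqP w1.
  have /eqP : z ^+ i = z ^+ j by rewrite -[RHS]mul1r -w1 mulfVK ?expf_neq0.
  by rewrite (eq_prim_root_expr zP) !modn_small.
apply: (mulfI w1); rewrite mulr0 -subrX1 expr_div_n -!exprM !(mulnC _ m).
by rewrite !exprM (prim_expr_order zP) !expr1n divr1 subrr.
Qed.

Lemma gradecompP i (a : K) x y :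
  gradecomp i (a *: x + y) = a *: gradecomp i x + gradecomp i y.
Proof.
rewrite /gradecomp scalerA mulrC -scalerA -scalerDr; congr (_ *: _).
rewrite scaler_sumr -big_split; apply: eq_bigr => k _ /=.
by rewrite iterP scalerDr !scalerA mulrC.
Qed.

Lemma gradecomp_mem i x : gradecomp i x \in grade i.
Proof.
apply/gradeP; rewrite linearZ linear_sum /= scalerA mulrC -scalerA.
congr (_ *: _); rewrite scaler_sumr.
pose f k := z ^+ i *: (z ^- (i * k) *: iter k theta x).
have f0m : f m = f 0.
  rewrite /f muln0 mulnC exprM (prim_expr_order zP) expr1n expr0.
  by case: thetaP => _ -> _.
transitivity (\sum_(k < m) f k.+1).
  apply: eq_bigr => k _; rewrite linearZ /f /= scalerA mulnS exprD invfM.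
  by rewrite mulrA divff ?expf_neq0 // mul1r.
by case: (m) f0m => [|n] f0m; rewrite ?big_ord0 // big_ord_recr f0m
  big_ord_recl /= addrC.
Qed.

Lemma gradecomp_id i j x : (i < m)%N -> (j < m)%N -> x \in grade i ->
  gradecomp j x = if i == j then x else 0.
Proof.
move=> ltim ltjm /gradeP tx; rewrite /gradecomp.
have itx k : iter k theta x = z ^+ (i * k) *: x.
  elim: k => [|k IHk] /=; first by rewrite muln0 scale1r.
  by rewrite IHk linearZ /= tx scalerA mulnS addnC exprD.
under eq_bigr => k _ do rewrite itx scalerA.
rewrite -scaler_suml sum_roots //; case: eqP => _.
  by rewrite scalerA mulVf // scale1r.
by rewrite scale0r scaler0.
Qed.

Lemma gradecomp_sum x : \sum_(i < m) gradecomp i x = x.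
Proof.
rewrite -scaler_sumr exchange_big /=.
transitivity (m%:R^-1 *:
    \sum_(k < m) (if 0%N == k then m%:R else 0) *: iter k theta x).
  congr (_ *: _); apply: eq_bigr => k _.
  rewrite -scaler_suml -sum_roots //; congr (_ *: _).
  by apply: eq_bigr => i _; rewrite mul0n expr0 mulr1 mulnC.
rewrite (bigD1 (Ordinal m_gt0)) //= big1 ?addr0 => [|k].
  by rewrite scalerA mulVf // scale1r.
by rewrite -val_eqE /= eq_sym => /negPf ->; rewrite scale0r.
Qed.

Lemma lie_grade i j x y : x \in grade i -> y \in grade j ->
  [lie x, y] \in grade (i + j).
Proof.
move=> /gradeP tx /gradeP ty; apply/gradeP.
by rewrite lauf_lie tx ty lieZl lieZr scalerA exprD.
Qed.

Lemma lie_grade_mod i j x y : (m <= i + j)%N ->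
  x \in grade i -> y \in grade j -> [lie x, y] \in grade (i + j - m).
Proof.
move=> lem xi yj; have /gradeP e := lie_grade xi yj; apply/gradeP.
by rewrite e -{1}(subnK lem) exprD (prim_expr_order zP) mulr1.
Qed.

Lemma contraction_bracketE i j x y : (i < m)%N -> (j < m)%N ->
    x \in grade i -> y \in grade j ->
  contraction_bracket x y = if (m <= i + j)%N then [lie x, y] else 0.
Proof.
move=> ltim ltjm xi yj; rewrite /contraction_bracket.
rewrite (bigD1 (Ordinal ltim)) //= [X in _ + X]big1 ?addr0 => [|k].
  rewrite (gradecomp_id _ _ xi) // eqxx; case: ifP => lem.
    rewrite (bigD1 (Ordinal ltjm)) //= (gradecomp_id _ _ yj) // eqxx.
    rewrite big1 ?addr0 // => k /andP[_]; rewrite -val_eqE /= eq_sym => nk.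
    by rewrite (gradecomp_id _ _ yj) // (negPf nk) lie0r.
  apply: big1 => k lek; rewrite (gradecomp_id _ _ yj) //.
  by case: eqP lek => [<-|_]; rewrite ?lem ?lie0r.
rewrite -val_eqE /= eq_sym => nk; apply: big1 => l _.
by rewrite (gradecomp_id _ _ xi) // (negPf nk) lie0l.
Qed.

Fact contraction_linearl (a : K) x y w :
  contraction_bracket (a *: x + y) w
    = a *: contraction_bracket x w + contraction_bracket y w.
Proof.
rewrite /contraction_bracket scaler_sumr -big_split; apply: eq_bigr => i _.
rewrite scaler_sumr -big_split; apply: eq_bigr => j _ /=.
by rewrite gradecompP lie_linearl.
Qed.

Fact contraction_linearr (a : K) x y w :
  contraction_bracket x (a *: y + w)
    = a *: contraction_bracket x y + contraction_bracket x w.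
Proof.
rewrite /contraction_bracket scaler_sumr -big_split; apply: eq_bigr => i _.
rewrite scaler_sumr -big_split; apply: eq_bigr => j _ /=.
by rewrite gradecompP lie_linearr.
Qed.

Fact contraction_liexx x : contraction_bracket x x = 0.
Proof.
rewrite /contraction_bracket.
suff S n : \sum_(i < n) \sum_(j < n | (m <= i + j)%N)
    [lie gradecomp i x, gradecomp j x] = 0 by exact: S.
elim: n => [|n IHn]; first by rewrite big_ord0.
pose F i j := if (m <= i + j)%N then [lie gradecomp i x, gradecomp j x] else 0.
have FC i j : F i j = - F j i.
  by rewrite /F addnC; case: ifP => _; rewrite ?oppr0 // lieC.
have FE p q : \sum_(i < p) \sum_(j < q | (m <= i + j)%N)
    [lie gradecomp i x, gradecomp j x] = \sum_(i < p) \sum_(j < q) F i j.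
  by apply: eq_bigr => i _; rewrite big_mkcond.
rewrite FE in IHn; rewrite FE big_ord_recr /=.
under eq_bigr => i _ do rewrite big_ord_recr /=.
rewrite big_split /= IHn add0r big_ord_recr /= addrA -big_split big1 => [|i _].
  by rewrite /F liexx if_same addr0.
by rewrite /= FC addNr.
Qed.

Let cbDl x y w : contraction_bracket (x + y) w
  = contraction_bracket x w + contraction_bracket y w.
Proof. by rewrite -[x]scale1r contraction_linearl !scale1r. Qed.
Let cbDr x y w : contraction_bracket x (y + w)
  = contraction_bracket x y + contraction_bracket x w.
Proof. by rewrite -[y]scale1r contraction_linearr !scale1r. Qed.
Let cb0l w : contraction_bracket 0 w = 0.
Proof. by apply: (addrI (contraction_bracket 0 w)); rewrite -cbDl !addr0. Qed.
Let cb0r x : contraction_bracket x 0 = 0.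
Proof. by apply: (addrI (contraction_bracket x 0)); rewrite -cbDr !addr0. Qed.
Let cb_suml (F : 'I_m -> L) w : contraction_bracket (\sum_i F i) w
  = \sum_i contraction_bracket (F i) w.
Proof. by elim/big_rec2: _ => [|i u v _ <-]; rewrite ?cb0l ?cbDl. Qed.
Let cb_sumr x (F : 'I_m -> L) : contraction_bracket x (\sum_i F i)
  = \sum_i contraction_bracket x (F i).
Proof. by elim/big_rec2: _ => [|i u v _ <-]; rewrite ?cb0r ?cbDr. Qed.

Let cb3 x y w : contraction_bracket x (contraction_bracket y w) =
  \sum_(i < m) \sum_(j < m) \sum_(k < m) if (m.*2 <= i + j + k)%N then
    [lie gradecomp i x, [lie gradecomp j y, gradecomp k w]] else 0.
Proof.
rewrite -{1}(gradecomp_sum x) (cb_suml (fun i => gradecomp i x)).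
apply: eq_bigr => i _.
rewrite -{1}(gradecomp_sum y) (cb_suml (fun j => gradecomp j y)).
rewrite (cb_sumr _ (fun j => contraction_bracket (gradecomp j y) w)).
apply: eq_bigr => j _.
rewrite -{1}(gradecomp_sum w) (cb_sumr _ (fun k => gradecomp k w)).
rewrite (cb_sumr _ (fun k => contraction_bracket _ (gradecomp k w))).
apply: eq_bigr => k _.
have [xi yj] := (gradecomp_mem i x, gradecomp_mem j y).
have wk := gradecomp_mem k w.
rewrite (contraction_bracketE _ _ yj wk) //.
have ltim := ltn_ord i; have ltjm := ltn_ord j; have ltkm := ltn_ord k.
case: ifP => lem; last by rewrite cb0r; case: ifP => // ?; exfalso; lia.
rewrite (contraction_bracketE _ _ xi (lie_grade_mod lem yj wk)) //; last lia.
by congr (if _ then _ else _); lia.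
Qed.

Fact contraction_jacobi x y w :
  contraction_bracket x (contraction_bracket y w)
    + contraction_bracket y (contraction_bracket w x)
    + contraction_bracket w (contraction_bracket x y) = 0.
Proof.
rewrite !cb3; under [X in _ + X + _]eq_bigr => j _ do rewrite exchange_big /=.
rewrite [X in _ + X + _]exchange_big /= [X in _ + X]exchange_big /=.
under [X in _ + X]eq_bigr => i _ do rewrite exchange_big /=.
rewrite -!big_split big1 //= => i _; rewrite -!big_split big1 //= => j _.
rewrite -!big_split big1 //= => k _.
have -> : (j + k + i = i + j + k)%N by lia.
have -> : (k + i + j = i + j + k)%N by lia.
by case: ifP => _; rewrite ?lie_jacobi ?addr0.
Qed.

Lemma gradecomp_fixed i s x : theta s = s ->
  gradecomp i [lie s, x] = [lie s, gradecomp i x].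
Proof.
move=> ts; rewrite lieZr lie_sumr; congr (_ *: _); apply: eq_bigr => k _.
rewrite lieZr; congr (_ *: _).
by elim: (k : nat) => //= n ->; rewrite lauf_lie ts.
Qed.

Fact contraction_ad_deriv s x y : theta s = s ->
  [lie s, contraction_bracket x y] =
    contraction_bracket [lie s, x] y + contraction_bracket x [lie s, y].
Proof.
move=> ts; rewrite lie_sumr -big_split; apply: eq_bigr => i _ /=.
rewrite lie_sumr -big_split; apply: eq_bigr => j _ /=.
rewrite !gradecomp_fixed //; move: (gradecomp i x) (gradecomp j y) => u v.
have := lie_jacobi s u v; rewrite [[lie v, s]]lieC lieNr.
rewrite [[lie v, _]]lieC -addrA -opprD => /eqP.
by rewrite subr_eq0 => /eqP ->; rewrite addrC.
Qed.

End Grading.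

(* The vector space L with the bracket contraction_bracket; the proofs zP and
   thetaP are parameters because the Jacobi identity depends on them. *)
Definition contraction (K : fieldType) (L : lieAlgType K) (theta : lieAut L)
  (m : nat) (z : K) (zP : m.-primitive_root z)
  (thetaP : lie_aut_order theta m) : Type := L.

Section Contraction.
Variables (K : fieldType) (L : lieAlgType K) (theta : lieAut L).
Variables (m : nat) (z : K).
Hypotheses (zP : m.-primitive_root z) (thetaP : lie_aut_order theta m).
Local Notation Loo := (contraction zP thetaP).
Local Notation L0 := (subvs_of (fixed_subalg theta)).

HB.instance Definition _ := Vector.copy Loo L.
HB.instance Definition _ := Vector_isLie.Build K Loo
  (contraction_linearl theta m z) (contraction_linearr theta m z)
  (contraction_liexx theta m z) (contraction_jacobi zP thetaP).

Definition ad_fixed (s : L0) (x : Loo) : Loo := [lie vsval s, x : L].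

Fact ad_fixed_linearl (a : K) (s t : L0) (x : Loo) :
  ad_fixed (a *: s + t) x = a *: ad_fixed s x + ad_fixed t x.
Proof. exact: (lie_linearl a (vsval s) (vsval t) (x : L)). Qed.
Fact ad_fixed_linearr (a : K) (s : L0) (x y : Loo) :
  ad_fixed s (a *: x + y) = a *: ad_fixed s x + ad_fixed s y.
Proof. exact: (lie_linearr a (vsval s) (x : L) (y : L)). Qed.
Fact ad_fixed_lie (s t : L0) (x : Loo) :
  ad_fixed [lie s, t] x
    = ad_fixed s (ad_fixed t x) - ad_fixed t (ad_fixed s x).
Proof.
have := lie_jacobi (vsval s) (vsval t) (x : L).
rewrite (lieC (x : L) (vsval s)) lieNr (lieC (x : L)) => /eqP.
by rewrite subr_eq0 => /eqP e; exact: esym e.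
Qed.
Fact ad_fixed_deriv (s : L0) (x y : Loo) :
  ad_fixed s [lie x, y] = [lie ad_fixed s x, y] + [lie x, ad_fixed s y].
Proof. exact: contraction_ad_deriv (fixedSpaceP (subvsP s)). Qed.

Definition ad_action : lieAction L0 Loo := LieAction
  ad_fixed_linearl ad_fixed_linearr ad_fixed_lie ad_fixed_deriv.

End Contraction.

(* Main.v *)
(* The Killing form [kf] of a semisimple [g] is nondegenerate by Cartan's
   criterion, and it pairs the degrees [i] and [m - i] of the grading, so it is
   also nondegenerate on the fixed subalgebra [g_0]. For a subalgebra [q] on
   which [kf] is nondegenerate every functional is [kf x] for some [x] in [q], its
   stabiliser is the centraliser of [x], and the least dimension of a centraliser
   is that of any Cartan subalgebra; hence the index of [g_0 (+) g] is the sum of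
   the ranks.

   The form defining the index of the semidirect product is the limit at [t = 0]
   of forms that for [t <> 0] come from [g_0 (+) g], through the scaling of degree
   [i] by [t ^ (m - i)]. Semicontinuity of the rank gives one inequality.

   For the other one, let [h] be generic in a Cartan subalgebra [H] of [g_0]. Its
   Fitting null space [C] in [g] is a graded subalgebra with degree [0] part [H].
   Jordan decomposition shows that a homogeneous [x] in [C] which commutes with
   the opposite degree and is [ad]-nilpotent on [C] is central in [C]; an
   induction on [gcd (i, m)] then makes [C] abelian. So [C] is a Cartan
   subalgebra, [h] is regular in both algebras, and the stabiliser of the
   functional [kf h] of the contraction lies in the sum of the centralisers of
   [h] in [g_0] and in [g]. *)

From HB Require Import structures.
Require Import Defs.
From mathcomp Require Import all_boot all_algebra.
From mathcomp Require Import boolp classical_sets zify ring.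

Set Implicit Arguments.
Unset Strict Implicit.
Unset Printing Implicit Defensive.

Import GRing.Theory VectorInternalTheory.
Local Open Scope ring_scope.

(** * Generic rank and primary decomposition of matrices *)

(** [lie_rank] measures an unspecified Cartan subalgebra, so its value has to be recovered from
    intrinsic data. The functionals [y |-> \tr (ad x ^+ k *m ad y)] vanish on [[x, q]] and so bound
    the dimension of the centraliser of [x] from below; at a generic [x] of a Cartan subalgebra they
    separate its points, since the eigenprojections of [ad x] are polynomials in [ad x].

    The action of [g_0] must be removed before the scaling can be used: [(s, x) |-> (s, s + x)]
    turns the semidirect product of [g_0] with the uncontracted [g] into the direct sum.

    Regularity of [h] in [g_0] says nothing a priori about the nonzero degrees, where no nonzero
    element of [H] lives. They are controlled by the semisimple part of [ad x] for homogeneous [x],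
    which nondegeneracy of [kf] turns into an element of [g]. *)

Section Cofinite.
Variable K : closedFieldType.

(** Genericity on the affine line: an algebraically closed field is infinite, so finitely many such
    conditions have a common solution. *)
Definition cofin (P : K -> Prop) : Prop :=
  exists2 p : {poly K}, p != 0 & forall t, ~~ root p t -> P t.

Lemma cofin_and P Q : cofin P -> cofin Q -> cofin (fun t => P t /\ Q t).
Proof.
move=> [p p0 hp] [q q0 hq]; exists (p * q); first by rewrite mulf_neq0.
by move=> t; rewrite rootM negb_or => /andP[/hp ? /hq ?].
Qed.

Lemma cofin_imp (P Q : K -> Prop) : (forall t, P t -> Q t) -> cofin P -> cofin Q.
Proof. by move=> PQ [p p0 hp]; exists p => // t /hp/PQ. Qed.

Lemma cofin_neq a : cofin (fun t => t != a).
Proof.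
exists ('X - a%:P); first by rewrite polyXsubC_eq0.
by move=> t; rewrite root_XsubC.
Qed.

Lemma cofin_root (p : {poly K}) : p != 0 -> cofin (fun t => p.[t] != 0).
Proof. by exists p. Qed.

Lemma cofin_ex P : cofin P -> exists t, P t.
Proof. by move=> [p /closed_nonrootP[t /[swap] h /h]]; exists t. Qed.

Lemma cofin_poly0 (p : {poly K}) : cofin (fun t => p.[t] = 0) -> p = 0.
Proof.
move=> cp; apply/eqP; apply/negPn/negP => /cofin_root/(cofin_and cp)/cofin_ex.
by move=> [t [-> ]]; rewrite eqxx.
Qed.

Definition evmx m n (t : K) (M : 'M[{poly K}]_(m, n)) : 'M[K]_(m, n) :=
  map_mx (horner_eval t) M.

Lemma evmxM m n p t (A : 'M_(m, n)) (B : 'M_(n, p)) :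
  evmx t (A *m B) = evmx t A *m evmx t B.
Proof. exact: map_mxM. Qed.

Lemma evmxX n t (A : 'M_n) k : evmx t (A ^+ k) = evmx t A ^+ k.
Proof. exact: rmorphXn. Qed.

Lemma evmxC m n t (A : 'M[K]_(m, n)) : evmx t (map_mx polyC A) = A.
Proof. by apply/matrixP => i j; rewrite !mxE /horner_eval hornerC. Qed.

Definition linemx m n (A B : 'M[K]_(m, n)) : 'M[{poly K}]_(m, n) :=
  map_mx polyC A + 'X *: map_mx polyC (B - A).

Lemma evmx_line m n t (A B : 'M[K]_(m, n)) :
  evmx t (linemx A B) = A + t *: (B - A).
Proof.
by apply/matrixP => i j; rewrite !mxE /horner_eval hornerD hornerM hornerX !hornerC.
Qed.

Lemma evmx_det n t (M : 'M_n) : (\det M).[t] = \det (evmx t M).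
Proof. by rewrite det_map_mx. Qed.

(** The constant multipliers [U] and [V] replace the choice of a minor: a lower bound on the rank
    becomes the nonvanishing of one determinant. *)
Lemma full_rank_minor m n (A : 'M[K]_(m, n)) :
  exists U, exists V, U *m A *m V = 1%:M :> 'M_(\rank A).
Proof.
exists (pinvmx (col_base A)), (pinvmx (row_base A)).
transitivity (pinvmx (col_base A) *m (col_base A *m row_base A) *m pinvmx (row_base A)).
  by rewrite mulmx_base.
by rewrite mulmxA mulVpmx ?col_base_full // mul1mx mulmxVp ?row_base_free.
Qed.

Lemma cofin_rank m n (M : 'M[{poly K}]_(m, n)) t0 :
  cofin (fun t => (\rank (evmx t0 M) <= \rank (evmx t M))%N).
Proof.
set A := evmx t0 M; have [U [V UAV]] := full_rank_minor A; set r := \rank A.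
pose D := \det (map_mx polyC U *m M *m map_mx polyC V).
have DE t : D.[t] = \det (U *m evmx t M *m V) by rewrite evmx_det !evmxM !evmxC.
have D0 : D != 0.
  apply: contraTneq (oner_neq0 K) => D0.
  by rewrite -(det1 K r) -UAV -/A -DE D0 horner0 eqxx.
apply: cofin_imp (cofin_root D0) => t; rewrite DE -unitfE => u.
have : \rank (U *m evmx t M *m V) = r by apply: mxrank_unit.
move=> <-; apply: leq_trans (mxrankM_maxl _ _) (mxrankM_maxr _ _).
Qed.

(** Lets a generic identity be specialised at an excluded value such as [t = 0]. *)
Lemma cofin_mx0 m n (M : 'M[{poly K}]_(m, n)) :
  cofin (fun t => evmx t M = 0) -> forall t, evmx t M = 0.
Proof.
move=> cM t; suff -> : M = 0 by apply/matrixP=> i j; rewrite !mxE /horner_eval horner0.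
apply/matrixP => i j; rewrite mxE; apply: cofin_poly0.
by apply: cofin_imp cM => u /matrixP/(_ i j); rewrite !mxE.
Qed.

End Cofinite.

(** * Traces of idempotent and nilpotent matrices *)

Section Trace.
Variable K : fieldType.

Lemma mxtrace_idem n (P : 'M[K]_n) : P *m P = P -> \tr P = (\rank P)%:R.
Proof.
move=> PP; rewrite -[in LHS](mulmx_base P) mxtrace_mulC.
suff -> : row_base P *m col_base P = 1%:M by rewrite mxtrace1.
apply: (row_free_inj (row_base_free P)); apply: (row_full_inj (col_base_full P)).
rewrite mul1mx; transitivity (P *m P); last by rewrite PP mulmx_base.
by rewrite -[in RHS](mulmx_base P) !mulmxA.
Qed.

(** By rank factorisation [\tr (C *m R) = \tr (R *m C)], and [R *m C] is again nilpotent but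
    smaller, unless [A] is invertible, which forces size 0. *)
Lemma mxtrace_nil n (A : 'M[K]_n) k : A ^+ k = 0 -> \tr A = 0.
Proof.
elim/ltn_ind: n A k => n IH A k Ak.
have [lt|ge] := ltnP (\rank A) n; last first.
  have /eqP fA : \rank A == n by rewrite eqn_leq rank_leq_row.
  have uA : A \in unitmx by rewrite -row_free_unit /row_free fA.
  case: n A Ak uA fA {IH ge} => [|n] A Ak uA fA; first by rewrite /mxtrace big_ord0.
  have : (1%:M : 'M[K]_n.+1) \in unitmx by rewrite unitmx1.
  have : A ^+ k \in unitmx by rewrite -[_ \in _]/(_ \is a GRing.unit) unitrX.
  by rewrite Ak unitmxE det0 unitr0.
set C := col_base A; set R := row_base A.
have CR : A = C *m R by rewrite mulmx_base.
rewrite CR mxtrace_mulC; apply: (IH _ lt _ k.+1).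
have E j : (R *m C) ^+ j.+1 = R *m A ^+ j *m C.
  elim: j => [|j IHj]; first by rewrite expr1 expr0 -[1]/(1%:M) mulmx1.
  rewrite exprS IHj [A ^+ j.+1]exprS -![_ * _]/(_ *m _).
  have -> : R *m (A *m A ^+ j) *m C = R *m (C *m R *m A ^+ j) *m C by rewrite -CR.
  by rewrite !mulmxA.
by rewrite E Ak mulmx0 mul0mx.
Qed.

End Trace.

(** * Primary decomposition and semisimple part of a matrix *)

Section Primary.
Variable K : closedFieldType.

Lemma coprimep_prod_seq (T : eqType) (s : seq T) (F : T -> {poly K}) p :
  {in s, forall a, coprimep p (F a)} -> coprimep p (\prod_(a <- s) F a).
Proof.
elim: s => [|a s IHs] h; first by rewrite big_nil coprimep1.
by rewrite big_cons coprimepMr h ?mem_head // IHs // => b bs; rewrite h // inE bs orbT.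
Qed.

Lemma coprimep_XsubC_exp (a b : K) i j : a != b ->
  coprimep (('X - a%:P) ^+ i) (('X - b%:P) ^+ j).
Proof.
move=> ab; apply/coprimep_expl/coprimep_expr.
by rewrite coprimep_XsubC root_XsubC eq_sym.
Qed.

Lemma dvdp_prod_coprime (s : seq K) n (g : {poly K}) : uniq s ->
  (forall a, a \in s -> ('X - a%:P) ^+ n %| g) ->
  \prod_(a <- s) ('X - a%:P) ^+ n %| g.
Proof.
elim: s => [|a s IHs] /=; first by rewrite big_nil dvd1p.
move=> /andP[as_ us] h; rewrite big_cons Gauss_dvdp.
  by rewrite h ?mem_head // IHs // => b bs; rewrite h // inE bs orbT.
apply: coprimep_prod_seq => b bs; apply: coprimep_XsubC_exp.
by apply: contraNneq as_ => ->.
Qed.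

(** Chinese remainder theorem for pairwise coprime powers. The disjunct [a \notin s] makes [f a]
    vanish modulo every factor when [a] is not in [s]. *)
Lemma idempotent_polys (s : seq K) n : uniq s -> exists f : K -> {poly K},
  forall a, (a \in s -> ('X - a%:P) ^+ n %| f a - 1) /\
    (forall b, b \in s -> b != a \/ a \notin s -> ('X - b%:P) ^+ n %| f a).
Proof.
move=> us; suff /choice[f fP] : forall a, exists fa : {poly K},
  (a \in s -> ('X - a%:P) ^+ n %| fa - 1) /\
    (forall b, b \in s -> b != a \/ a \notin s -> ('X - b%:P) ^+ n %| fa) by exists f.
move=> a; have [as_|_] := boolP (a \in s); last by exists 0; split=> // b _ _; rewrite dvdp0.
pose Q := \prod_(b <- rem a s) ('X - b%:P) ^+ n.
have /Bezout_eq1_coprimepP[[u v] /= uv] : coprimep (('X - a%:P) ^+ n) Q.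
  apply: coprimep_prod_seq => b; rewrite mem_rem_uniq // inE => /andP[ba _].
  by apply: coprimep_XsubC_exp; rewrite eq_sym.
exists (v * Q); split=> [_|b bs [ba|]]; last by move=> /negP[].
  by rewrite -uv opprD addrCA subrr addr0 dvdpNr dvdp_mull.
apply: dvdp_mull; rewrite /Q (big_rem b) /= ?dvdp_mulr //.
by rewrite mem_rem_uniq // inE ba.
Qed.

(** Cayley-Hamilton turns congruences modulo [P], a multiple of the characteristic polynomial, into
    matrix identities. Expanding [e a] in powers of [A] lets invariance and commutation pass from
    [A] to [e a]. *)
Lemma primary_decomp n (A : 'M[K]_n) : exists N (s : seq K) (e : K -> 'M[K]_n),
  [/\ uniq s, \sum_(a <- s) e a = 1%:M, (forall a, a \notin s -> e a = 0),
      forall a, exists c : nat -> K, e a = \sum_(k < N) c k *: A ^+ k &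
      (forall a, (A - a%:M) ^+ n *m e a = 0) /\
      (forall a b, a != b -> e a *m e b = 0)].
Proof.
case: n A => [|n] A.
  exists 0%N, [::], (fun=> 0); split=> //; try by split=> *; rewrite thinmx0.
    by rewrite big_nil thinmx0.
  by move=> a; exists (fun=> 0); rewrite big_ord0.
have [rs rsE] := closed_field_poly_normal (char_poly A).
rewrite (monicP (char_poly_monic A)) scale1r in rsE.
pose s := undup rs; have us : uniq s := undup_uniq rs.
pose N := n.+1; pose P := \prod_(a <- s) ('X - a%:P) ^+ N.
have size_rs : size rs = N.
  by have := size_char_poly A; rewrite rsE size_prod_XsubC => -[].
have AP g : P %| g -> horner_mx A g = 0.
  move=> Pg; have /dvdpP[q ->] : char_poly A %| g.
    apply: dvdp_trans Pg; rewrite rsE /P prodrXl -size_rs.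
    have : {subset rs <= s} by move=> a; rewrite mem_undup.
    move: {us P} s; elim: rs {rsE size_rs} => [|a r IHr] s sub; first by rewrite big_nil dvd1p.
    rewrite big_cons exprS; apply: dvdp_mul; last first.
      by apply: IHr => b br; apply: sub; rewrite inE br orbT.
    by rewrite (big_rem a) ?dvdp_mulr // sub ?mem_head.
  by rewrite rmorphM /= Cayley_Hamilton mulr0.
have [f fP] := idempotent_polys N us.
pose e a := horner_mx A (if a \in s then f a else 0).
have fE a : a \in s -> e a = horner_mx A (f a) by rewrite /e => ->.
have dP := dvdp_prod_coprime us.
exists (size P), s, e; split=> //.
- apply/eqP; rewrite -subr_eq0; apply/eqP.
  have -> : \sum_(a <- s) e a - 1%:M = horner_mx A (\sum_(a <- s) f a - 1).
    rewrite rmorphB rmorph_sum /=; congr (_ - _); last exact: (esym (rmorph1 (horner_mx A))).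
    by apply: eq_big_seq => a /fE.
  apply: AP; apply: dP => b bs; rewrite (big_rem b) //= addrAC dvdp_add //.
    by have [-> ] := fP b.
  rewrite big_seq; apply: (big_ind (fun q => ('X - b%:P) ^+ N %| q)) => [|p q|a]; rewrite ?dvdp0 //; first exact: dvdp_add.
  rewrite mem_rem_uniq // inE => /andP[ab as_]; have [_ -> //] := fP a.
  by left; rewrite eq_sym.
- by move=> a /negPf as_; rewrite /e as_ rmorph0.
- move=> a; set p := if a \in s then f a else 0.
  exists (fun k => (p %% P)`_k); rewrite /e -/p.
  have -> : horner_mx A p = horner_mx A (p %% P).
    by rewrite {1}(divp_eq p P) rmorphD /= AP ?add0r // dvdp_mull.
  have P0 : P != 0 by rewrite prodf_seq_neq0; apply/allP => b _ /=;
    rewrite expf_neq0 // polyXsubC_eq0.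
  have lt : (size (p %% P)%R <= size P)%N by rewrite ltnW // ltn_modp.
  have {1}-> : p %% P = \poly_(i < size P) (p %% P)`_i.
    apply/polyP => i; rewrite coef_poly; case: ltnP => // h.
    by rewrite nth_default // (leq_trans lt).
  rewrite poly_def rmorph_sum /=; apply: eq_bigr => i _.
  by rewrite linearZ /= rmorphXn /= horner_mx_X.
- split=> [a|a b ab].
    have -> : (A - a%:M) ^+ N = horner_mx A (('X - a%:P) ^+ N).
      by rewrite rmorphXn rmorphB /= horner_mx_X horner_mx_C.
    rewrite -[_ *m _]/(_ * _) -rmorphM /=; apply: AP; apply: dP => b bs.
    have [->|ba] := eqVneq b a; first by rewrite dvdp_mulr.
    rewrite dvdp_mull //; case: ifP => as_; last by rewrite dvdp0.
    by have [_ ->] := fP a; auto.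
  rewrite -[_ *m _]/(_ * _) -rmorphM /=; apply: AP; apply: dP => c cs.
  case: ifP => as_; last by rewrite mul0r dvdp0.
  case: ifP => bs; last by rewrite mulr0 dvdp0.
  have [ca|ca] := eqVneq c a; last by rewrite dvdp_mulr //; have [_ ->] := fP a; auto.
  rewrite dvdp_mull //; have [_ -> //] := fP b.
  by left; rewrite ca.
Qed.

Section Projections.
Variables (n : nat) (A : 'M[K]_n).

Definition is_primary (d : nat) (s : seq K) (e : K -> 'M[K]_n) : Prop :=
  [/\ uniq s, \sum_(a <- s) e a = 1%:M, (forall a, a \notin s -> e a = 0),
      forall a, exists c : nat -> K, e a = \sum_(k < d) c k *: A ^+ k &
      (forall a, (A - a%:M) ^+ n *m e a = 0) /\
      (forall a b, a != b -> e a *m e b = 0)].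

Fact primary_ex : exists t : nat * seq K * (K -> 'M[K]_n), is_primary t.1.1 t.1.2 t.2.
Proof. by have [d [s [e h]]] := primary_decomp A; exists (d, s, e). Qed.

Definition primary_data := projT1 (cid primary_ex).
Definition spec_deg := primary_data.1.1.
Definition spec := primary_data.1.2.
Definition prj := primary_data.2.

Fact prjP : is_primary spec_deg spec prj.
Proof. exact: projT2 (cid primary_ex). Qed.

Lemma spec_uniq : uniq spec. Proof. by have [] := prjP. Qed.
Lemma prj_sum : \sum_(a <- spec) prj a = 1%:M. Proof. by have [] := prjP. Qed.
Lemma prj_out a : a \notin spec -> prj a = 0.
Proof. by have [_ _ + _ _] := prjP; apply. Qed.
Lemma prj_powers a : exists c : nat -> K, prj a = \sum_(k < spec_deg) c k *: A ^+ k.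
Proof. by have [_ _ _ + _] := prjP; apply. Qed.
Lemma prj_nil a : (A - a%:M) ^+ n *m prj a = 0.
Proof. by have [_ _ _ _ [+ _]] := prjP; apply. Qed.
Lemma prj_orth a b : a != b -> prj a *m prj b = 0.
Proof. by have [_ _ _ _ [_]] := prjP; apply. Qed.

Lemma prj_sum_mulr m (v : 'M_(m, n)) : v = \sum_(a <- spec) v *m prj a.
Proof. by rewrite -mulmx_sumr prj_sum mulmx1. Qed.

(** Spreads one component over all of [spec], so that it can be compared term by term with
    [prj_sum_mulr]. *)
Lemma prj_pick m (v : 'M_(m, n)) b :
  \sum_(a <- spec) (if a == b then v *m prj a else 0) = v *m prj b.
Proof.
have [bs|bs] := boolP (b \in spec).
  rewrite (bigD1_seq b) ?spec_uniq //= eqxx big1 ?addr0 // => a.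
  by case: eqVneq.
rewrite prj_out // mulmx0 -big_mkcond big_seq_cond big1 //= => a /andP[as_ /eqP ab].
by rewrite -ab as_ in bs.
Qed.

Lemma prj_idem a : prj a *m prj a = prj a.
Proof.
rewrite [RHS]prj_sum_mulr -[LHS]prj_pick; apply: eq_bigr => b _.
by case: eqVneq => // ab; rewrite prj_orth // eq_sym.
Qed.

Lemma prj_comm B a : B *m A = A *m B -> B *m prj a = prj a *m B.
Proof.
move=> BA; have [c ->] := prj_powers a; rewrite mulmx_sumr mulmx_suml.
apply: eq_bigr => k _; rewrite -scalemxAr -scalemxAl; congr (_ *: _).
exact: (commrX k (BA : GRing.comm B A)).
Qed.

Lemma prj_nilr m (v : 'M_(m, n)) a k : (n <= k)%N -> v *m prj a *m (A - a%:M) ^+ k = 0.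
Proof.
move=> nk; suff E : prj a *m (A - a%:M) ^+ k = 0 by rewrite -mulmxA E mulmx0.
rewrite -prj_comm; last exact: (commr_sym (commrX k (commrB (commr_refl A) (scalar_mxC a A)))).
by rewrite -(subnK nk) exprD -[_ * _]/(_ *m _) -mulmxA prj_nil mulmx0.
Qed.

(** Induction on [k + j] reduces to a vector killed by both [A - a%:M] and [A - b%:M], hence by
    their nonzero scalar difference. *)
Lemma geig_disjoint m (v : 'M_(m, n)) a b k j : a != b ->
  v *m (A - a%:M) ^+ k = 0 -> v *m (A - b%:M) ^+ j = 0 -> v = 0.
Proof.
move=> ab; have cab : GRing.comm (A - a%:M) (A - b%:M).
  apply: commrB; last exact: scalar_mxC.
  by apply: commr_sym; apply: commrB => //; apply: scalar_mxC.
have [N] := ubnP (k + j); elim: N k j v => // N IHN [|k] [|j] v lt.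
- by rewrite expr0 mulmx1.
- by rewrite expr0 mulmx1.
- by move=> _; rewrite expr0 mulmx1.
move=> vk vj; have va : v *m (A - a%:M) = 0.
  apply: (IHN k j.+1) => //; first by rewrite -mulmxA -[_ *m _ ^+ k]exprS.
  have e : _ *m _ = _ *m _ := commrX j.+1 cab.
  by rewrite -mulmxA e mulmxA vj mul0mx.
have vb : v *m (A - b%:M) = 0.
  apply: (IHN k.+1 j) => //; first by rewrite -ltnS (leq_trans _ lt) // addnS.
    have e : _ *m _ = _ *m _ := commrX k.+1 (commr_sym cab).
    by rewrite -mulmxA e mulmxA vk mul0mx.
  by rewrite -mulmxA -[_ *m _ ^+ j]exprS.
have : v *m ((A - a%:M) - (A - b%:M)) = 0 by rewrite mulmxBr va vb subrr.
rewrite opprD addrACA subrr add0r opprK addrC -raddfB mul_mx_scalar => /eqP.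
by rewrite scalemx_eq0 subr_eq0 eq_sym (negPf ab) => /eqP.
Qed.

Lemma prj_id m (v : 'M_(m, n)) a k : v *m (A - a%:M) ^+ k = 0 -> v *m prj a = v.
Proof.
move=> vk; rewrite [RHS]prj_sum_mulr -prj_pick; apply: eq_bigr => b _.
case: eqVneq => // ba; apply: esym; apply: (@geig_disjoint _ _ a b k n).
- by rewrite eq_sym.
- rewrite -mulmxA -prj_comm ?mulmxA ?vk ?mul0mx //.
  exact: (commr_sym (commrX k (commrB (commr_refl A) (scalar_mxC a A)))).
- exact: prj_nilr.
Qed.

Lemma prj_id0 m (v : 'M_(m, n)) a b k :
  v *m (A - a%:M) ^+ k = 0 -> a != b -> v *m prj b = 0.
Proof. by move=> /prj_id <- ab; rewrite -mulmxA prj_orth // mulmx0. Qed.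

Lemma prj_shift (X : 'M_n) d :
  (forall b (v : 'rV_n), v *m (A - b%:M) ^+ n = 0 ->
     exists k, v *m X *m (A - (b + d)%:M) ^+ k = 0) ->
  forall b, prj b *m X = X *m prj (b + d).
Proof.
move=> h b; apply/row_matrixP => i; rewrite !row_mul.
set u := delta_mx 0 i : 'rV[K]_n; rewrite !rowE -/u.
have hb c : exists k, u *m prj c *m X *m (A - (c + d)%:M) ^+ k = 0.
  by apply: h; apply: prj_nilr.
rewrite -[u *m prj b]prj_pick {2}(prj_sum_mulr u) !mulmx_suml.
apply: eq_bigr => c _; have [k hk] := hb c.
case: eqVneq => [<-|cb]; first by rewrite (prj_id hk).
rewrite mul0mx (prj_id0 hk) //; apply: contra cb => /eqP/addIr ->; exact: eqxx.
Qed.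

(** The semisimple part in the Jordan decomposition of [A]. *)
Definition ssmx : 'M[K]_n := \sum_(a <- spec) a *: prj a.

Lemma ssmx_prj a : ssmx *m prj a = a *: prj a.
Proof.
rewrite /ssmx mulmx_suml -[in RHS](mul1mx (prj a)) -prj_pick scaler_sumr.
apply: eq_bigr => b _; rewrite -scalemxAl; case: eqVneq => [->|ab].
  by rewrite prj_idem mul1mx.
by rewrite prj_orth // !scaler0.
Qed.

Lemma ssmx_comm B : B *m A = A *m B -> B *m ssmx = ssmx *m B.
Proof.
move=> BA; rewrite /ssmx mulmx_sumr mulmx_suml; apply: eq_bigr => a _.
by rewrite -scalemxAr -scalemxAl prj_comm.
Qed.

Lemma ssmx_nil : (A - ssmx) ^+ n = 0.
Proof.
rewrite -[LHS]mulmx1 -prj_sum mulmx_sumr big1 // => a _.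
suff E k : (A - ssmx) ^+ k *m prj a = (A - a%:M) ^+ k *m prj a by rewrite E prj_nil.
elim: k => [|k IHk]; first by rewrite !expr0.
rewrite !exprS -![_ * _]/(_ *m _) -!mulmxA IHk.
have -> : (A - a%:M) ^+ k *m prj a = prj a *m (A - a%:M) ^+ k.
  apply: esym; rewrite -prj_comm //.
  exact: (commr_sym (commrX k (commrB (commr_refl A) (scalar_mxC a A)))).
by rewrite !mulmxA !mulmxBl ssmx_prj -mul_scalar_mx.
Qed.

Lemma mxtrace_prj a : \tr (prj a) = (\rank (prj a))%:R.
Proof. exact: mxtrace_idem (prj_idem a). Qed.

End Projections.
End Primary.

(** * Generalised eigenspaces of the adjoint representation *)

Lemma v2r_hom (K : fieldType) (V W : vectType K) (f : 'Hom(V, W)) v : v2r (f v) = v2r v *m f2mx f.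
Proof. by rewrite unlock /= r2vK. Qed.

Section Ad.
Variables (K : closedFieldType) (g : lieAlgType K).
Implicit Types (x y z h v : g) (a b mu nu : K) (U V H : {vspace g}).
Local Notation n := (vector.dim g).

Lemma lieBl x y z : [lie x - y, z] = [lie x, z] - [lie y, z].
Proof. by rewrite lieDl lieNl. Qed.

Lemma lieBr x y z : [lie x, y - z] = [lie x, y] - [lie x, z].
Proof. by rewrite lieDr lieNr. Qed.

Lemma lie_leibniz x y z : [lie x, [lie y, z]] = [lie [lie x, y], z] + [lie y, [lie x, z]].
Proof.
have /eqP := lie_jacobi x y z; rewrite -addrA addr_eq0 => /eqP ->.
by rewrite (lieC z x) lieNr (lieC z) opprD !opprK addrC.
Qed.

Lemma v2rB x y : v2r (x - y) = v2r x - v2r y. Proof. exact: linearB. Qed.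
Lemma v2rZ a x : v2r (a *: x) = a *: v2r x. Proof. exact: linearZ. Qed.

Definition adl x : 'End(g) := linfun (lie_bracket x).

Fact lie_is_linear x : linear (lie_bracket x). Proof. by move=> a y z; rewrite lie_linearr. Qed.
HB.instance Definition _ x := GRing.isLinear.Build K g g _ (lie_bracket x) (lie_is_linear x).

Lemma adlE x y : adl x y = [lie x, y]. Proof. exact: lfunE. Qed.

(* Matrices act on coordinate rows from the right, so [adm] reverses products. *)
Definition adm x : 'M[K]_n := f2mx (adl x).

Lemma v2r_adm x y : v2r y *m adm x = v2r [lie x, y].
Proof. by rewrite -v2r_hom adlE. Qed.

Lemma v2r_adm_inj (A B : 'M[K]_n) : (forall v, v2r v *m A = v2r v *m B) -> A = B.
Proof.
move=> AB; apply/row_matrixP => i; rewrite !rowE.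
by rewrite -(r2vK (delta_mx 0 i)) AB.
Qed.

Lemma adm_linear a x y : adm (a *: x + y) = a *: adm x + adm y.
Proof.
apply: v2r_adm_inj => v; rewrite mulmxDr -scalemxAr !v2r_adm lie_linearl.
by rewrite linearP.
Qed.
HB.instance Definition _ := GRing.isLinear.Build K g 'M[K]_n _ adm adm_linear.

Lemma adm_lie x y : adm [lie x, y] = adm y *m adm x - adm x *m adm y.
Proof.
apply: v2r_adm_inj => v; rewrite mulmxBr !mulmxA !v2r_adm -linearB /=.
by rewrite lie_leibniz addrK.
Qed.

Lemma adm_comm x y : [lie x, y] = 0 -> adm x *m adm y = adm y *m adm x.
Proof.
move=> xy; apply/eqP; rewrite eq_sym -subr_eq0 -adm_lie xy linear0.
exact: eqxx.
Qed.

Definition gew h mu v : Prop := exists k, v2r v *m (adm h - mu%:M) ^+ k = 0.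

Definition pj h mu : 'End(g) := Hom (prj (adm h) mu).

Lemma v2r_pj h mu v : v2r (pj h mu v) = v2r v *m prj (adm h) mu.
Proof. exact: v2r_hom. Qed.

Lemma gewP h mu v : gew h mu v <-> pj h mu v = v.
Proof.
split=> [[k hk]|e]; first by apply: v2r_inj; rewrite v2r_pj (prj_id hk).
by exists n; rewrite -e v2r_pj prj_nilr.
Qed.

Lemma gew_n h mu v k : (n <= k)%N -> gew h mu v -> v2r v *m (adm h - mu%:M) ^+ k = 0.
Proof. by move=> nk /gewP <-; rewrite v2r_pj prj_nilr. Qed.

Lemma pj_gew h mu v : gew h mu (pj h mu v).
Proof. by apply/gewP; apply: v2r_inj; rewrite !v2r_pj -mulmxA prj_idem. Qed.

Lemma gew_lin h mu a x y : gew h mu x -> gew h mu y -> gew h mu (a *: x + y).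
Proof. by move=> /gewP hx /gewP hy; apply/gewP; rewrite linearP /= hx hy. Qed.

Lemma gew0 h mu : gew h mu 0.
Proof. by exists 0%N; rewrite linear0 mul0mx. Qed.

Lemma gewS h mu v : [lie h, v] = mu *: v -> gew h mu v.
Proof.
by move=> e; exists 1%N; rewrite expr1 mulmxBr v2r_adm e mul_mx_scalar linearZ /= subrr.
Qed.

Lemma v2r_admB h mu v : v2r v *m (adm h - mu%:M) = v2r ([lie h, v] - mu *: v).
Proof. by rewrite mulmxBr v2r_adm mul_mx_scalar v2rB v2rZ. Qed.

(** By the Leibniz rule [ad h - (mu + nu)] acts on the bracket through [ad h - mu] on [x] plus
    [ad h - nu] on [y]; each term lowers the sum of the nilpotency exponents. *)
Lemma gew_lie h mu nu x y : gew h mu x -> gew h nu y -> gew h (mu + nu) [lie x, y].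
Proof.
move=> [i hi] [j hj]; have [N] := ubnP (i + j).
elim: N i j x y hi hj => // N IHN i j x y hi hj lt.
case: i hi lt => [|i] hi lt.
  by move: hi; rewrite expr0 mulmx1 -(linear0 v2r) => /v2r_inj ->; rewrite lie0l; apply: gew0.
case: j hj lt => [|j] hj lt.
  by move: hj; rewrite expr0 mulmx1 -(linear0 v2r) => /v2r_inj ->; rewrite lie0r; apply: gew0.
have E : [lie h, [lie x, y]] - (mu + nu) *: [lie x, y] =
   [lie [lie h, x] - mu *: x, y] + [lie x, [lie h, y] - nu *: y].
  by rewrite lieBl lieBr lieZl lieZr lie_leibniz scalerDl opprD addrACA.
have : gew h (mu + nu) ([lie h, [lie x, y]] - (mu + nu) *: [lie x, y]).
  rewrite E -[X in gew _ _ (X + _)]scale1r; apply: gew_lin.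
    apply: (IHN i j.+1) => //; first by rewrite -v2r_admB -mulmxA -[_ *m _ ^+ i]exprS.
  apply: (IHN i.+1 j) => //; first by rewrite -v2r_admB -mulmxA -[_ *m _ ^+ j]exprS.
  by rewrite -ltnS (leq_trans _ lt) // addnS.
by move=> [k hk]; exists k.+1; rewrite exprS -[_ * _]/(_ *m _) mulmxA v2r_admB.
Qed.

Lemma gew_sub h mu U v : (forall u, u \in U -> [lie h, u] \in U) -> v \in U -> pj h mu v \in U.
Proof.
move=> hU vU; have [c cE] := prj_powers (adm h) mu.
rewrite -[pj h mu v]v2rK v2r_pj cE mulmx_sumr linear_sum memv_suml // => k _.
rewrite -scalemxAr linearZ memvZ //=.
elim: (k : nat) => [|j IHj]; first by rewrite expr0 mulmx1 v2rK.
by rewrite exprSr -[_ * _]/(_ *m _) mulmxA -[X in X *m _]r2vK v2r_adm v2rK hU.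
Qed.

Lemma pj_sum h v : v = \sum_(a <- spec (adm h)) pj h a v.
Proof.
apply: v2r_inj; rewrite linear_sum /= {1}(prj_sum_mulr (adm h) (v2r v)).
by apply: eq_bigr => a _; rewrite v2r_pj.
Qed.

Lemma pj_neq h mu nu v : gew h mu v -> mu != nu -> pj h nu v = 0.
Proof. by move=> [k hk] mn; apply: v2r_inj; rewrite v2r_pj (prj_id0 hk) // linear0. Qed.

Lemma adm_shift h mu x nu : gew h mu x ->
  prj (adm h) nu *m adm x = adm x *m prj (adm h) (nu + mu).
Proof.
move=> hx; apply: prj_shift => b v vb.
have [k] : gew h (b + mu) [lie x, r2v v].
  by rewrite addrC; apply: gew_lie => //; exists n; rewrite r2vK.
by rewrite -v2r_adm r2vK => e; exists k.
Qed.

Definition kf x y : K := \tr (adm x *m adm y).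

Lemma kfC x y : kf x y = kf y x. Proof. exact: mxtrace_mulC. Qed.

Lemma kf_linearl a x y z : kf (a *: x + y) z = a * kf x z + kf y z.
Proof. by rewrite /kf linearP mulmxDl -scalemxAl linearP. Qed.
Lemma kf_linearr a x y z : kf z (a *: x + y) = a * kf z x + kf z y.
Proof. by rewrite kfC kf_linearl !(kfC _ z). Qed.
Lemma kf0l y : kf 0 y = 0. Proof. by rewrite /kf linear0 mul0mx mxtrace0. Qed.
Lemma kf0r y : kf y 0 = 0. Proof. by rewrite kfC kf0l. Qed.
Lemma kfDl x y z : kf (x + y) z = kf x z + kf y z.
Proof. by rewrite -[x]scale1r kf_linearl scale1r mul1r. Qed.
Lemma kfDr x y z : kf z (x + y) = kf z x + kf z y.
Proof. by rewrite !(kfC z) kfDl. Qed.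
Lemma kfZl a x z : kf (a *: x) z = a * kf x z.
Proof. by rewrite -[a *: x]addr0 kf_linearl kf0l addr0. Qed.
Lemma kfZr a x z : kf z (a *: x) = a * kf z x.
Proof. by rewrite !(kfC z) kfZl. Qed.
Lemma kfNl x z : kf (- x) z = - kf x z.
Proof. by rewrite -scaleN1r kfZl mulN1r. Qed.
Lemma kfBl x y z : kf (x - y) z = kf x z - kf y z.
Proof. by rewrite kfDl kfNl. Qed.
Lemma kf_suml I (r : seq I) (P : pred I) (F : I -> g) y :
  kf (\sum_(i <- r | P i) F i) y = \sum_(i <- r | P i) kf (F i) y.
Proof. by elim/big_rec2: _ => [|i u v _ <-]; rewrite ?kf0l ?kfDl. Qed.
Lemma kf_sumr I (r : seq I) (P : pred I) (F : I -> g) y :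
  kf y (\sum_(i <- r | P i) F i) = \sum_(i <- r | P i) kf y (F i).
Proof. by rewrite kfC kf_suml; apply: eq_bigr => i _; rewrite kfC. Qed.

Lemma kf_inv x y z : kf [lie x, y] z = kf x [lie y, z].
Proof.
rewrite /kf !adm_lie mulmxBl mulmxBr !linearB /= -!mulmxA; congr (_ - _).
by rewrite mxtrace_mulC -!mulmxA.
Qed.

End Ad.

(** * Engel's theorem and regular elements *)

Section Engel.
Variables (K : closedFieldType) (g : lieAlgType K).
Implicit Types (x y z h v c a b : g) (s t mu nu : K) (U V W H A B L : {vspace g}).
Local Notation n := (vector.dim g).

Lemma exists_notin U W : ~~ (W <= U)%VS -> exists2 v, v \in W & v \notin U.
Proof. by move=> /subvPn[v]; exists v. Qed.

Lemma iter_lie_gew c v k : v2r (iter k (lie_bracket c) v) = v2r v *m adm c ^+ k.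
Proof.
elim: k => [|k IHk]; first by rewrite expr0 mulmx1.
by rewrite exprSr -[_ * _]/(_ *m _) mulmxA -IHk v2r_adm.
Qed.

Lemma scalar_mx0 m : 0%:M = 0 :> 'M[K]_m.
Proof. by rewrite -scalemx1 scale0r. Qed.

Lemma gew0P c v : gew c 0 v <-> exists k, iter k (lie_bracket c) v = 0.
Proof.
rewrite /gew scalar_mx0 subr0; split=> -[k] hk; exists k.
  by apply: v2r_inj; rewrite iter_lie_gew hk linear0.
by rewrite -iter_lie_gew hk linear0.
Qed.

(** Relative form of Engel's theorem, for [A] acting on [W] modulo [U]. The induction hypothesis for
    a maximal proper subalgebra [B] acting on [A] modulo [B] yields [z] normalising [B], so [B] has
    codimension one. *)
Lemma engel A U W : lie_closed A ->
  (forall a w, a \in A -> w \in W -> [lie a, w] \in W) ->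
  (forall a u, a \in A -> u \in U -> [lie a, u] \in U) ->
  ~~ (W <= U)%VS ->
  (forall a w, a \in A -> w \in W -> exists k, iter k (lie_bracket a) w \in U) ->
  (forall a b, a \in A -> b \in A -> gew a 0 b) ->
  exists v, [/\ v \in W, v \notin U & forall a, a \in A -> [lie a, v] \in U].
Proof.
have [N] := ubnP (\dim A); elim: N A U W => // N IHN A U W ltA clA AW AU WU nilW nilA.
have [A0|A0] := eqVneq A 0%VS.
  have [v vW vU] := exists_notin WU; exists v; split=> // a.
  by rewrite A0 memv0 => /eqP ->; rewrite lie0l mem0v.
pose P k := `[< (k < \dim A)%N /\ exists B, [/\ (B <= A)%VS, lie_closed B & \dim B = k] >].
have exP : exists k, P k.
  exists 0%N; apply/asboolP; rewrite lt0n dimv_eq0; split=> //; exists 0%VS.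
  split; [exact: sub0v| |by rewrite dimv0].
  by move=> x y; rewrite !memv0 => /eqP-> _; rewrite lie0l.
have ubP k : P k -> (k <= \dim A)%N by move=> /asboolP[/ltnW].
case: (ex_maxnP exP ubP) => k /asboolP[ltk [B [BA clB dB]]] maxk.
have inA b : b \in B -> b \in A by apply: (subvP BA).
have ltBN : (\dim B < N)%N by rewrite dB (leq_trans ltk) // -ltnS.
have [z [zA zB Bz]] : exists v, [/\ v \in A, v \notin B & forall a, a \in B -> [lie a, v] \in B].
  apply: IHN => //.
  - by move=> a w /inA aA wA; apply: clA.
  - by apply: contraL ltk => /dimvS; rewrite dB leqNgt.
  - by move=> a w /inA aA wA; have /gew0P[i e] := nilA a w aA wA; exists i; rewrite e mem0v.
  - by move=> a b /inA aA /inA bA; apply: nilA.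
have BzA : (B + <[z]> = A)%VS.
  apply/eqP; rewrite eqEdim subv_add BA -memvE zA /=.
  have dimBz : \dim (B + <[z]>)%VS = k.+1.
    rewrite dimv_disjoint_sum ?dim_vline ?dB.
      by rewrite (_ : z != 0) ?addn1 //; apply: contraNneq zB => ->; apply: mem0v.
    apply/eqP; rewrite -subv0; apply/subvP => v; rewrite memv_cap => /andP[vB /vlineP[a va]].
    move: vB; rewrite va rpredZeq; case: eqVneq => [-> _|_] /=; first by rewrite scale0r mem0v.
    by rewrite (negPf zB).
  rewrite dimBz leqNgt; apply/negP => lek.
  have : P k.+1; last by move=> /maxk; rewrite ltnn.
  apply/asboolP; split=> //.
  exists (B + <[z]>)%VS; split=> //; first by rewrite subv_add BA -memvE.
  move=> x y /memv_addP[x1 x1B [_ /vlineP[a ->] ->]] /memv_addP[y1 y1B [_ /vlineP[b ->] ->]].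
  rewrite lieDl !lieDr !lieZl !lieZr liexx !scaler0 addr0.
  apply: (subvP (addvSl _ _)); rewrite rpredD ?rpredZ //; last first.
    by rewrite lieC rpredN Bz.
  by rewrite rpredD ?clB ?memvZ ?Bz.
have [v0 [v0W v0U Bv0]] : exists v, [/\ v \in W, v \notin U & forall a, a \in B -> [lie a, v] \in U].
  apply: IHN => //.
  - by move=> a w /inA; apply: AW.
  - by move=> a w /inA; apply: AU.
  - by move=> a w /inA; apply: nilW.
  - by move=> a b /inA aA /inA bA; apply: nilA.
(* Since [z] normalises [B], every iterate is killed by [B] modulo [U]; the last iterate outside [U]
   is killed by [z] as well. *)
pose v j := iter j (lie_bracket z) v0.
have vW j : v j \in W by elim: j => //= j; apply: AW.
have Bv j b : b \in B -> [lie b, v j] \in U.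
  elim: j b => [|j IHj] b bB; first exact: Bv0.
  by rewrite /v iterS -/(v j) lie_leibniz rpredD ?(IHj _ (Bz _ bB)) // AU ?IHj.
have exU : exists j, v j \in U by apply: nilW.
case: (ex_minnP exU) => -[|j] vjU minj; first by rewrite vjU in v0U.
exists (v j); split=> //; first by apply: contraT; rewrite negbK => /minj; rewrite ltnn.
move=> a; rewrite -BzA => /memv_addP[b bB [_ /vlineP[t ->] ->]].
by rewrite lieDl lieZl rpredD ?Bv // memvZ.
Qed.

End Engel.

(** * Fitting null spaces and regular elements *)

Section Regular.
Variables (K : closedFieldType) (g : lieAlgType K).
Implicit Types (x y z h v c a b : g) (s t mu nu : K) (U V W H A B L : {vspace g}).
Local Notation n := (vector.dim g).

Lemma gew0_n c v : gew c 0 v <-> v2r v *m adm c ^+ n = 0.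
Proof.
split=> [/(gew_n (leqnn n))|e]; last by exists n; rewrite scalar_mx0 subr0.
by rewrite scalar_mx0 subr0.
Qed.

Lemma adm_line x y t : adm (x + t *: (y - x)) = evmx t (linemx (adm x) (adm y)).
Proof. by rewrite evmx_line linearD linearZ linearB. Qed.

Lemma gew_self h : gew h 0 h.
Proof. by apply: gewS; rewrite liexx scale0r. Qed.

Lemma adm_shift0 h x nu : gew h 0 x -> prj (adm h) nu *m adm x = adm x *m prj (adm h) nu.
Proof. by move=> /adm_shift ->; rewrite addr0. Qed.

Lemma gewD h mu x y : gew h mu x -> gew h mu y -> gew h mu (x + y).
Proof. by rewrite -{2}[x]scale1r; apply: gew_lin. Qed.
Lemma gewZ h mu t x : gew h mu x -> gew h mu (t *: x).
Proof. by rewrite -[t *: x]addr0 => hx; apply: gew_lin (gew0 _ _). Qed.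
Lemma gewB h mu x y : gew h mu x -> gew h mu y -> gew h mu (x - y).
Proof. by rewrite -scaleN1r => hx hy; apply: gewD => //; apply: gewZ. Qed.

(* At [t = 1] the [n]-th power of [ad] is injective on the complement of the
   Fitting null space of [h]; injectivity persists for generic [t]. *)
Lemma cofin_gew h c : gew h 0 c ->
  cofin (fun t => forall v, gew (c + t *: (h - c)) 0 v -> gew h 0 v).
Proof.
move=> hc; set P := prj (adm h) 0; set Q := 1%:M - P.
have PP : P *m P = P by apply: prj_idem.
pose M := map_mx polyC Q *m linemx (adm c) (adm h) ^+ n.
have ME t : evmx t M = Q *m adm (c + t *: (h - c)) ^+ n.
  by rewrite evmxM evmxC evmxX adm_line.
have r1 : \rank (evmx 1 M) = \rank Q.
  rewrite ME scale1r addrCA subrr addr0 -(mxrank_mul_ker Q (adm h ^+ n)).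
  suff -> : (Q :&: kermx (adm h ^+ n))%MS = 0 by rewrite mxrank0 addn0.
  apply/eqP; rewrite -submx0; apply/rV_subP => w; rewrite sub_capmx submx0.
  move=> /andP[/submxP[u ->] /sub_kermxP wk].
  have : u *m Q *m P = u *m Q by apply: (@prj_id _ _ _ _ _ _ n); rewrite scalar_mx0 subr0.
  by move=> <-; rewrite -mulmxA mulmxBl mul1mx PP subrr mulmx0.
apply: cofin_imp (cofin_rank M 1) => t; rewrite r1 ME.
set Y := adm _ => rk v vY.
have PY : P *m Y = Y *m P.
  by apply: adm_shift0; apply: gewD => //; apply/gewZ/gewB => //; apply: gew_self.
have QY : Q *m Y ^+ n = Y ^+ n *m Q.
  by apply: commrX; rewrite /Q; apply: commr_sym; apply: commrB; [apply: commr1 | apply: esym].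
suff vQ : v2r v *m Q = 0.
  apply/gewP; apply: v2r_inj; rewrite v2r_pj; apply/esym/eqP.
  by rewrite -subr_eq0 -[X in X - _]mulmx1 -mulmxBr -/P -/Q vQ.
have : \rank (Q :&: kermx (Y ^+ n))%MS = 0%N.
  by apply/eqP; rewrite -leqn0 -(leq_add2l (\rank (Q *m Y ^+ n))) mxrank_mul_ker addn0.
move=> /eqP; rewrite mxrank_eq0 => /eqP k0; apply/eqP; rewrite -submx0 -k0 sub_capmx.
rewrite submxMl /=; apply/sub_kermxP; rewrite -mulmxA QY mulmxA.
by move/gew0_n: vY => ->; rewrite mul0mx.
Qed.

Definition fitting h L : {vspace g} := (limg (pj h 0) :&: L)%VS.

Lemma fittingP h L v : reflect (gew h 0 v /\ v \in L) (v \in fitting h L).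
Proof.
rewrite memv_cap; apply: (iffP andP) => -[hv vL]; split=> //.
  by move/memv_imgP: hv => [u _ ->]; apply: pj_gew.
by apply/memv_imgP; exists v; rewrite ?memvf //; apply/esym/gewP.
Qed.

(** Choose [h] with Fitting null space of least dimension. For [c] in it, generic points of the line
    through [c] and [h] have a null space contained in that of [h], hence equal to it; a power of
    [ad] then kills [v] generically on the line, so also at [c]. *)
Lemma regular_element L : lie_closed L -> exists2 h, h \in L &
  forall c v, c \in L -> v \in L -> gew h 0 c -> gew h 0 v -> gew c 0 v.
Proof.
move=> clL; pose fit h := fitting h L; have fitP h v := fittingP h L v.
pose P k := `[< exists2 h, h \in L & \dim (fit h) = k >].
have exP : exists k, P k by exists (\dim (fit 0)); apply/asboolP; exists 0; rewrite ?mem0v.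
case: (ex_minnP exP) => k /asboolP[h hL <-] minh {k}; exists h => // c v cL vL hc hv.
pose M := map_mx polyC (v2r v) *m linemx (adm c) (adm h) ^+ n.
have ME t : evmx t M = v2r v *m adm (c + t *: (h - c)) ^+ n.
  by rewrite evmxM evmxC evmxX adm_line.
apply/gew0_n; have := ME 0; rewrite scale0r addr0 => <-.
apply: cofin_mx0; apply: cofin_imp (cofin_gew hc) => t sub.
rewrite ME; apply/gew0_n.
set y := c + _ in sub *; have yL : y \in L by rewrite rpredD ?rpredZ ?rpredB.
have sub' : (fit y <= fit h)%VS.
  by apply/subvP => u /fitP[/sub hu uL]; apply/fitP.
have : fit y = fit h.
  apply/eqP; rewrite eqEdim sub' /=; apply: minh; apply/asboolP.
  by exists y.
by move=> e; have /fitP[] : v \in fit y by rewrite e; apply/fitP.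
Qed.

End Regular.

(** * Weights *)

Section Weights.
Variables (K : closedFieldType) (charK0 : [pchar K] =i pred0) (g : lieAlgType K).
Implicit Types (x y z h v c a b : g) (s t mu nu : K) (U V W H A B L : {vspace g}).
Local Notation n := (vector.dim g).

Lemma natr0 k : (k%:R == 0 :> K) = (k == 0)%N.
Proof. by move/pcharf0P: charK0 => ->. Qed.

Lemma mxrank_tr_eq0 (P : 'M[K]_n) : P *m P = P -> (\tr P == 0) = (P == 0).
Proof. by move=> /mxtrace_idem ->; rewrite natr0 mxrank_eq0. Qed.

Definition nil_family H : Prop := forall c b, c \in H -> b \in H -> gew c 0 b.

Definition commutant H (P : 'M[K]_n) : Prop := forall c, c \in H -> adm c *m P = P *m adm c.

Lemma tr_unipotent (P A : 'M[K]_n) t k : P *m P = P -> A *m P = P *m A ->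
  P *m (A - t%:M) ^+ k = 0 -> \tr (P *m A) = t * \tr P.
Proof.
move=> PP AP nil; have cP : GRing.comm P (A - t%:M).
  by apply: commrB; [apply: esym | apply: scalar_mxC].
have : \tr (P *m (A - t%:M)) = 0.
  apply: (@mxtrace_nil _ _ _ k.+1); rewrite -[P *m _]/(P * _) (exprMn_comm _ cP).
  rewrite exprSr [X in _ * X]exprSr -mulrA [X in _ * X]mulrA.
  by rewrite [P * _]nil mul0r mulr0.
by rewrite mulmxBr linearB /= mul_mx_scalar linearZ /= => /eqP; rewrite subr_eq0 => /eqP.
Qed.

(* An idempotent commuting with [ad H] on whose image some [ad c] has two
   eigenvalues splits further. *)
Lemma splitting H (P : 'M[K]_n) : nil_family H -> P *m P = P -> commutant H P ->
  exists2 l : seq 'M[K]_n, \sum_(Q <- l) Q = P &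
    forall Q, Q \in l -> [/\ Q != 0, Q *m Q = Q, commutant H Q &
      forall c, c \in H -> exists t, Q *m (adm c - t%:M) ^+ n = 0].
Proof.
move=> nilH; have [N] := ubnP (\rank P); elim: N P => // N IHN P lt PP cP.
have [->|P0] := eqVneq P 0; first by exists [::]; rewrite ?big_nil.
have [prim|] := pselect (forall c, c \in H -> exists t, P *m (adm c - t%:M) ^+ n = 0).
  by exists [:: P]; rewrite ?big_seq1 // => Q; rewrite inE => /eqP ->.
move=> /existsNP[c /not_implyP[cH /forallNP Pc]].
have [t Pt] : exists t, P *m prj (adm c) t != 0.
  apply: contrapT => /forallNP h; case/negP: P0; rewrite (prj_sum_mulr (adm c) P).
  by rewrite big1 // => t _; apply/eqP/negPn/negP/h.
set E := prj (adm c) t in Pt; set Q1 := P *m E; set Q2 := P - Q1.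
have EP : E *m P = P *m E by apply: esym; apply: prj_comm; rewrite cP.
have EE : E *m E = E by apply: prj_idem.
have PQ1 : P *m Q1 = Q1 by rewrite mulmxA PP.
have Q1P : Q1 *m P = Q1 by rewrite -mulmxA EP mulmxA PP.
have Q11 : Q1 *m Q1 = Q1 by rewrite {2}/Q1 mulmxA Q1P -mulmxA EE.
have Q22 : Q2 *m Q2 = Q2.
  by rewrite mulmxBl !mulmxBr PP PQ1 Q1P Q11 subrr subr0.
have Q20 : Q2 != 0.
  rewrite subr_eq0; apply/eqP => e; apply: (Pc t).
  by rewrite e /Q1 prj_nilr.
have cE : commutant H E by move=> b bH; rewrite /E adm_shift0 //; apply: nilH.
have c1 : commutant H Q1 by move=> b bH; rewrite mulmxA cP // -!mulmxA cE.
have c2 : commutant H Q2 by move=> b bH; rewrite mulmxBr mulmxBl c1 // cP.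
(* Ranks of idempotents are their traces, so they add up in [K]; characteristic 0 brings the
   equality back to natural numbers. *)
have /eqP : (\rank P)%:R - (\rank Q1 + \rank Q2)%:R = 0 :> K.
  by rewrite natrD -!mxtrace_idem // linearB /= addrCA subrr addr0 subrr.
rewrite subr_eq0 => /eqP rk.
have {}rk : \rank P = (\rank Q1 + \rank Q2)%N.
  apply/eqP; move/eqP: rk; case: (leqP (\rank P) (\rank Q1 + \rank Q2)) => [le|/ltnW le].
    rewrite eq_sym -subr_eq0 -natrB // natr0 subn_eq0 => ?; by rewrite eqn_leq le.
  by rewrite -subr_eq0 -natrB // natr0 subn_eq0 => ?; rewrite eqn_leq le andbT.
have r1 : (0 < \rank Q1)%N by rewrite lt0n mxrank_eq0.
have r2 : (0 < \rank Q2)%N by rewrite lt0n mxrank_eq0.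
have [|l1 s1 h1] := IHN Q1 _ Q11 c1.
  by rewrite -ltnS; apply: leq_trans lt; rewrite rk ltnS -addn1 leq_add2l.
have [|l2 s2 h2] := IHN Q2 _ Q22 c2.
  by rewrite -ltnS; apply: leq_trans lt; rewrite rk ltnS -add1n leq_add2r.
exists (l1 ++ l2); first by rewrite big_cat /= s1 s2 addrC subrK.
by move=> Q; rewrite mem_cat => /orP[/h1|/h2].
Qed.

(** Over an infinite field [H] is not a finite union of proper hyperplanes: if [f i] kills [h] but
    not [c], then [t *: c + h] with generic [t] leaves its kernel without entering the others. *)
Lemma avoid_kernels (T : eqType) (l : seq T) (f : T -> g -> K) H :
  (forall i t x y, f i (t *: x + y) = t * f i x + f i y) ->
  exists2 h, h \in H & forall i, i \in l -> f i h = 0 -> forall c, c \in H -> f i c = 0.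
Proof.
move=> lin; elim: l => [|i l [h hH IH]]; first by exists 0; rewrite ?mem0v.
have [ok|] := pselect (f i h = 0 -> forall c, c \in H -> f i c = 0).
  by exists h => // j; rewrite inE => /orP[/eqP -> //|/IH].
move=> /not_implyP[fh /existsNP[c /not_implyP[cH fc]]].
have cof j : j \in l -> cofin (fun t => f j (t *: c + h) = 0 -> forall b, b \in H -> f j b = 0).
  move=> jl; have [e|ne] := eqVneq (f j h) 0.
    by apply: cofin_imp (cofin_neq 0) => t _ _; apply: IH.
  exists ((f j c) *: 'X + (f j h)%:P).
    by apply: contra ne => /eqP/(congr1 (fun p => p.[0])); rewrite /= !hornerE ?mulr0 ?add0r => ->.
  move=> t; rewrite rootE !hornerE lin [f j c * t]mulrC => /eqP nz e; by [].
have : cofin (fun t => t != 0 /\ forall j, j \in l ->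
    f j (t *: c + h) = 0 -> forall b, b \in H -> f j b = 0).
  apply: cofin_and (cofin_neq 0) _; elim: l {IH} cof => [|j l IHl] cof.
    by apply: cofin_imp (cofin_neq 0).
  have cj := cof j (mem_head _ _).
  have := cofin_and cj (IHl (fun k kl => cof k (mem_behead (s := j :: l) kl))).
  by apply: cofin_imp => t [hj hl] k; rewrite inE => /orP[/eqP ->|/hl].
move=> /cofin_ex[t [t0 ht]]; exists (t *: c + h); first by rewrite rpredD ?rpredZ.
move=> j; rewrite inE => /orP[/eqP ->|/ht //].
by rewrite lin fh addr0 => /eqP; rewrite mulf_eq0 (negPf t0) => /eqP.
Qed.

(* The weights of [H] are labelled by their values at a generic [h]; [wt mu] is
   meaningful only if [mu] is an eigenvalue of [ad h]. *)
Record weight_data H h (wt : K -> g -> K) : Prop := WeightData {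
  wd_in : h \in H;
  wd_lin : forall mu t x y, wt mu (t *: x + y) = t * wt mu x + wt mu y;
  wd_nil : forall mu c, c \in H -> prj (adm h) mu *m (adm c - (wt mu c)%:M) ^+ n = 0;
  wd_0 : forall c, c \in H -> wt 0 c = 0;
  wd_h : forall mu, prj (adm h) mu != 0 -> wt mu h = mu;
  wd_add : forall mu nu, prj (adm h) mu != 0 -> prj (adm h) nu != 0 ->
    prj (adm h) (mu + nu) != 0 -> forall c, c \in H -> wt (mu + nu) c = wt mu c + wt nu c }.

Lemma weights H : nil_family H -> exists h wt, weight_data H h wt.
Proof.
move=> nilH; have c1 : commutant H 1%:M by move=> c _; rewrite mulmx1 mul1mx.
have [l suml hl] := splitting nilH (mulmx1 _) c1.
pose la (Q : 'M[K]_n) c := \tr (Q *m adm c) / \tr Q.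
have laL Q t x y : la Q (t *: x + y) = t * la Q x + la Q y.
  by rewrite /la linearP mulmxDr -scalemxAr linearP /= mulrDl mulrA.
have laN Q c : Q \in l -> c \in H -> Q *m (adm c - (la Q c)%:M) ^+ n = 0.
  move=> /hl[Q0 QQ cQ nQ] cH; have [t ht] := nQ c cH.
  suff <- : t = la Q c by [].
  by rewrite /la (tr_unipotent QQ (cQ c cH) ht) mulfK // mxrank_tr_eq0.
have la0 c : la 0 c = 0 by rewrite /la mul0mx linear0 mul0r.
(* Avoiding the kernels of these functionals makes an additive relation between weights hold on [H]
   once it holds at [h]. Entries equal to the zero matrix, where [la] is 0, cover equality and
   vanishing of weights. *)
pose f (T : 'M[K]_n * 'M[K]_n * 'M[K]_n) c := la T.1.1 c + la T.1.2 c - la T.2 c.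
have fL T t x y : f T (t *: x + y) = t * f T x + f T y.
  by rewrite /f !laL; ring.
have [h hH hP] := avoid_kernels
  [seq (p.1, p.2, q) | p <- [seq (p, q) | p <- 0 :: l, q <- 0 :: l], q <- 0 :: l] H fL.
have add Q1 Q2 Q3 : Q1 \in 0 :: l -> Q2 \in 0 :: l -> Q3 \in 0 :: l ->
    la Q1 h + la Q2 h = la Q3 h -> forall c, c \in H -> la Q1 c + la Q2 c = la Q3 c.
  move=> l1 l2 l3 e c cH; apply/eqP; rewrite -subr_eq0; apply/eqP.
  apply: (hP (Q1, Q2, Q3)) => //; last by rewrite /f /= e subrr.
  apply: (allpairs_f (fun p q => (p.1, p.2, q)) (x := (Q1, Q2))) => //.
  exact: (allpairs_f pair).
have z0 : 0 \in 0 :: l := mem_head _ _.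
have same Q1 Q2 : Q1 \in 0 :: l -> Q2 \in 0 :: l -> la Q1 h = la Q2 h ->
    forall c, c \in H -> la Q1 c = la Q2 c.
  by move=> l1 l2 e c cH; rewrite -(add Q1 0 Q2) ?la0 ?addr0.
(* The default 0 answers for values [mu] that no member of [l] takes at [h]. *)
pose q mu := nth 0 l (find (fun Q => la Q h == mu) l).
have ql mu : q mu \in 0 :: l.
  rewrite /q; case: (ltnP (find (fun Q => la Q h == mu) l) (size l)) => lt.
    by rewrite inE mem_nth ?orbT.
  by rewrite nth_default.
have qP Q : Q \in l -> la (q (la Q h)) h = la Q h.
  move=> Ql; apply/eqP; apply: (@nth_find _ 0 (fun R => la R h == la Q h)).
  by apply/hasP; exists Q => //=.
have prjE mu : prj (adm h) mu = \sum_(Q <- l) (if la Q h == mu then Q else 0).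
  rewrite -[LHS]mul1mx -suml mulmx_suml big_seq [RHS]big_seq; apply: eq_bigr => Q Ql.
  have nQ := laN Q h Ql hH; case: eqVneq => [<-|ne]; first exact: prj_id nQ.
  exact: prj_id0 nQ ne.
have prj0 mu : prj (adm h) mu != 0 -> exists2 Q, Q \in l & la Q h = mu.
  move=> p0; apply: contrapT => /forall2NP no; case/negP: p0; rewrite prjE big_seq big1 // => Q Ql.
  by case: eqVneq => // e; case: (no Q).
have qh mu : prj (adm h) mu != 0 -> la (q mu) h = mu.
  by move=> /prj0[Q Ql <-]; apply: qP.
have l0 Q : Q \in l -> Q \in 0 :: l by move=> Ql; rewrite inE Ql orbT.
exists h, (fun mu => la (q mu)); split=> //.
- move=> mu c cH; rewrite prjE mulmx_suml big_seq big1 // => Q Ql.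
  case: eqVneq => [<-|_]; last by rewrite mul0mx.
  by rewrite (same (q (la Q h)) Q) ?laN ?qP ?ql ?l0.
- move=> c cH; rewrite -[RHS](la0 c); apply: same => //.
  rewrite la0 /q; case: (ltnP (find (fun Q => la Q h == 0) l) (size l)) => lt.
    by apply/eqP; apply: (@nth_find _ 0 (fun R => la R h == 0)); rewrite has_find.
  by rewrite nth_default.
- by move=> mu nu p1 p2 p3 c cH; apply/esym; apply: add; rewrite ?qh.
Qed.

End Weights.

(** * Cartan's criterion *)

Section QPos.
Variables (K : closedFieldType) (charK0 : [pchar K] =i pred0).

(** The nonnegative rationals inside the unordered field [K]; a vanishing sum of them has vanishing
    terms. *)
Definition qpos (x : K) : Prop := exists N M : nat, (0 < N)%N /\ N%:R * x = M%:R.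

Lemma qpos_add x y : qpos x -> qpos y -> qpos (x + y).
Proof.
move=> [N [M [N0 e]]] [N' [M' [N0' e']]]; exists (N * N')%N, (N' * M + N * M')%N.
rewrite muln_gt0 N0 N0' natrD !natrM -e -e'; split=> //; ring.
Qed.

Lemma qpos_add0 x y : qpos x -> qpos y -> x + y = 0 -> x = 0.
Proof.
move=> [N [M [N0 e]]] [N' [M' [N0' e']]] xy.
have : (N' * M + N * M')%N%:R == 0 :> K.
  rewrite natrD !natrM -e -e'.
  have -> : N'%:R * (N%:R * x) + N%:R * (N'%:R * y) = N%:R * N'%:R * (x + y) by ring.
  by rewrite xy mulr0.
rewrite natr0 // addn_eq0 => /andP[]; rewrite muln_eq0 eqn0Ngt N0' /= => /eqP M0 _.
by apply/eqP; move/eqP: e; rewrite M0 mulf_eq0 natr0 // eqn0Ngt N0.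
Qed.

Lemma qpos_sum0 (T : eqType) (s : seq T) (F : T -> K) : {in s, forall i, qpos (F i)} ->
  \sum_(i <- s) F i = 0 -> {in s, forall i, F i = 0}.
Proof.
move=> qF; have qS (r : seq T) : {subset r <= s} -> qpos (\sum_(i <- r) F i).
  elim: r => [|i r IHr] sub; first by exists 1%N, 0%N; rewrite big_nil mulr0.
  rewrite big_cons; apply: qpos_add; first by apply/qF/sub/mem_head.
  by apply: IHr => j jr; apply: sub; rewrite inE jr orbT.
move=> S0 i is_; apply: (@qpos_add0 _ (\sum_(j <- rem i s) F j)); first exact: qF.
  by apply: qS => j /mem_rem.
by rewrite -[RHS]S0 [RHS](big_rem i) /=.
Qed.

End QPos.

Section Criterion.
Variables (K : closedFieldType) (charK0 : [pchar K] =i pred0) (g : lieAlgType K).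
Implicit Types (x y z h v c a b : g) (s t mu nu : K) (U V W H A B L D : {vspace g}).
Local Notation n := (vector.dim g).

Section WeightTraces.
Variables (H : {vspace g}) (h : g) (wt : K -> g -> K).
Hypotheses (nilH : nil_family H) (wd : weight_data H h wt).

Lemma wd_comm c mu : c \in H -> prj (adm h) mu *m adm c = adm c *m prj (adm h) mu.
Proof. by move=> cH; apply/adm_shift0/nilH => //; apply: wd_in wd. Qed.

Lemma wd_tr c mu : c \in H -> \tr (prj (adm h) mu *m adm c) = wt mu c * \tr (prj (adm h) mu).
Proof.
move=> cH; apply: (tr_unipotent (prj_idem _ _) (esym (wd_comm mu cH)) (wd_nil wd mu cH)).
Qed.

Lemma wd_tr2 c mu : c \in H ->
  \tr (prj (adm h) mu *m (adm c *m adm c)) = wt mu c ^+ 2 * \tr (prj (adm h) mu).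
Proof.
move=> cH; have cc := wd_comm mu cH; have nil := wd_nil wd mu cH.
apply: (@tr_unipotent _ _ _ _ _ n); first exact: prj_idem.
  by rewrite -mulmxA -cc !mulmxA cc.
set t := wt mu c in nil *; set A := adm c in cc nil *.
have -> : A *m A - (t ^+ 2)%:M = (A - t%:M) *m (A + t%:M).
  rewrite mulmxBl !mulmxDr -scalar_mxM -expr2 opprD addrA.
  by rewrite scalar_mxC addrK.
rewrite -[(A - t%:M) *m _]/(_ * _) exprMn_comm.
  by rewrite -[_ * _]/(_ *m _) mulmxA nil mul0mx.
apply: commrD; first by apply: commr_sym; apply: commrB => //; apply: scalar_mxC.
by apply: commr_sym; apply: commrB; [exact: esym (scalar_mxC _ _) | ].
Qed.

Lemma wd_kf c : c \in H -> kf c c = \sum_(mu <- spec (adm h)) wt mu c ^+ 2 * \tr (prj (adm h) mu).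
Proof.
move=> cH; rewrite /kf -[adm c *m adm c]mul1mx -(prj_sum (adm h)) mulmx_suml linear_sum.
by apply: eq_bigr => mu _; rewrite /= wd_tr2.
Qed.

(** Polarisation: on [H] the value [kf c c] depends only on the weights at [c], so adding an element
    with zero weights does not change it. *)
Lemma wd_wt_kf0 c c' : c \in H -> c' \in H ->
  (forall mu, prj (adm h) mu != 0 -> wt mu c = 0) -> kf c c' = 0.
Proof.
move=> cH cH' w0; have e : kf (c + c') (c + c') = kf c' c'.
  rewrite !wd_kf ?rpredD //; apply: eq_bigr => mu _.
  have [-> | p0] := eqVneq (prj (adm h) mu) 0; first by rewrite mxtrace0 !mulr0.
  by rewrite -[c]scale1r (wd_lin wd) w0 // mulr0 add0r.
have e0 : kf c c = 0.
  rewrite wd_kf // big1 // => mu _.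
  have [-> | p0] := eqVneq (prj (adm h) mu) 0; first by rewrite mxtrace0 !mulr0.
  by rewrite w0 // expr0n mul0r.
have : 2%:R * kf c c' == 0.
  move/eqP: e; rewrite kfDl !kfDr e0 (kfC c' c) add0r addrA -subr_eq0 addrK.
  by rewrite mulr_natl mulr2n.
by rewrite mulf_eq0 natr0 //= => /eqP.
Qed.

Lemma wd_gew v : gew h 0 v -> forall c, c \in H -> gew c 0 v.
Proof.
move=> /gewP hv c cH; exists n.
have := wd_nil wd 0 cH; rewrite (wd_0 wd cH) => e.
by rewrite -hv v2r_pj -mulmxA e mulmx0.
Qed.

Lemma wd_wt0 mu : wt mu 0 = 0.
Proof.
have := wd_lin wd mu 1 0 0; rewrite scaler0 addr0 mul1r -{1}[wt mu 0]addr0.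
by move/addrI.
Qed.

Lemma string_end mu nu : mu != 0 -> exists k : nat, prj (adm h) (nu + k%:R * mu) == 0.
Proof.
move=> mu0; apply: contrapT => /forallNP no.
pose s := [seq nu + k%:R * mu | k <- iota 0 (size (spec (adm h))).+1].
have us : uniq s.
  rewrite map_inj_in_uniq ?iota_uniq // => i j _ _ /addrI /(mulIf mu0) ij.
  apply/eqP; case: (leqP i j) ij => [le|/ltnW le] /eqP.
    by rewrite eq_sym -subr_eq0 -natrB // natr0 // subn_eq0 => ?; rewrite eqn_leq le.
  by rewrite -subr_eq0 -natrB // natr0 // subn_eq0 => ?; rewrite eqn_leq le andbT.
have sub : {subset s <= spec (adm h)}.
  move=> _ /mapP[k _ ->]; apply: contraT => /prj_out e; case: (no k).
  by rewrite e.
by have := uniq_leq_size us sub; rewrite size_map size_iota ltnn.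
Qed.

(** The sum of the weight spaces on the unbroken [mu]-string through [nu] is stable under [ad x] and
    [ad y], so their commutator has trace 0 on it. This is a linear relation with natural
    coefficients between the lowest weight and [mu]. *)
Lemma weight_string x y mu nu : mu != 0 -> gew h mu x -> gew h (- mu) y ->
  [lie x, y] \in H -> prj (adm h) mu != 0 -> prj (adm h) nu != 0 ->
  exists (N : nat) (Z : int), (0 < N)%N /\ N%:R * wt nu [lie x, y] = Z%:~R * wt mu [lie x, y].
Proof.
move=> mu0 hx hy cH pmu pnu; set c := [lie x, y] in cH *.
have Nmu0 : - mu != 0 by rewrite oppr_eq0.
have exk := string_end nu Nmu0.
case: (ex_minnP exk) => -[|p]; first by rewrite mul0r addr0 (negPf pnu).
(* [be] is the last weight met going down from [nu], and [r] below marks the first gap going up from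
   [be]; [p < r] says that [nu] lies on the string. *)
move=> /eqP pp minp; set be := nu + p%:R * - mu.
have beE (j : nat) : be + j%:R * mu = nu + (p%:R - j%:R) * - mu.
  by rewrite /be mulrBl !mulrN opprK addrA.
have below (j : nat) : (j <= p)%N -> prj (adm h) (be + j%:R * mu) != 0.
  move=> jp; rewrite beE -natrB //; apply/negP => /minp.
  by rewrite ltnNge leq_subr.
have exr := string_end be mu0.
case: (ex_minnP exr) => r /eqP rr minr.
have pr : (p < r)%N by rewrite ltnNge; apply/negP => /below; rewrite rr eqxx.
have inr (j : nat) : (j < r)%N -> prj (adm h) (be + j%:R * mu) != 0.
  by move=> jr; apply/negP => /minr; rewrite leqNgt jr.
have beS (j : nat) : be + j%:R * mu + mu = be + j.+1%:R * mu.
  by rewrite -natr1 mulrDl mul1r addrA.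
have wtE (j : nat) : (j < r)%N -> wt (be + j%:R * mu) c = wt be c + j%:R * wt mu c.
  elim: j => [|j IHj] jr; first by rewrite !mul0r !addr0.
  have nz := inr _ jr; rewrite -beS in nz *.
  rewrite (wd_add wd (inr _ (ltnW jr)) pmu nz cH) (IHj (ltnW jr)).
  by rewrite -natr1 mulrDl mul1r addrA.
have bm : prj (adm h) (be - mu) = 0.
  by rewrite -[RHS]pp /be -natr1 mulrDl mul1r addrA.
pose f j := prj (adm h) (be + j%:R * mu); pose P := \sum_(j < r) f j.
have tele : \sum_(j < r) f j.+1 = P - f 0%N.
  apply/eqP; rewrite -subr_eq0 opprB addrA subr_eq0; apply/eqP.
  rewrite addrC -(big_ord_recl r (fun j => f j)) big_ord_recr /=.
  by rewrite [f r]rr addr0.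
have fx j : f j *m adm x = adm x *m f j.+1.
  by rewrite /f (adm_shift _ hx) beS.
have fy j : f j.+1 *m adm y = adm y *m f j.
  by rewrite /f (adm_shift _ hy) -beS addrK.
have Px : P *m adm x = adm x *m P.
  have -> : P *m adm x = adm x *m \sum_(j < r) f j.+1.
    by rewrite mulmx_suml mulmx_sumr; apply: eq_bigr => j _; rewrite fx.
  rewrite tele mulmxBr.
  suff -> : adm x *m f 0%N = 0 by rewrite subr0.
  by rewrite /f mul0r addr0 -(subrK mu be) -(adm_shift _ hx) bm mul0mx.
have Py : P *m adm y = adm y *m P.
  have -> : adm y *m P = (\sum_(j < r) f j.+1) *m adm y.
    by rewrite mulmx_suml mulmx_sumr; apply: eq_bigr => j _; rewrite fy.
  rewrite tele mulmxBl.
  suff -> : f 0%N *m adm y = 0 by rewrite subr0.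
  by rewrite /f mul0r addr0 (adm_shift _ hy) bm mulmx0.
have tr0 : \tr (P *m adm c) = 0.
  rewrite /c adm_lie mulmxBr linearB /= mulmxA Py -mulmxA mxtrace_mulC.
  by rewrite -mulmxA subrr.
pose m j := \rank (f j).
have sum0 : (\sum_(j < r) m j)%:R * wt be c + (\sum_(j < r) j * m j)%:R * wt mu c = 0.
  rewrite -tr0 /P mulmx_suml linear_sum !natr_sum !mulr_suml -big_split /=.
  apply: eq_bigr => j _; rewrite wd_tr // wtE // mxtrace_prj // natrM /m /f; ring.
(* [N] is the dimension of the string; [Z] comes from substituting [nu = be + p%:R * mu] into
   [sum0]. *)
exists (\sum_(j < r) m j)%N, (p%:Z * (\sum_(j < r) m j)%N%:Z - (\sum_(j < r) j * m j)%N%:Z)%R.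
split.
  rewrite lt0n sum_nat_eq0; apply/forallPn; exists (Ordinal pr) => /=.
  by rewrite mxrank_eq0 inr.
have -> : nu = be + p%:R * mu by rewrite beE subrr mul0r addr0.
rewrite wtE // rmorphB rmorphM /= -!pmulrn mulrBl mulrDr.
move/eqP: sum0; rewrite addr_eq0 => /eqP ->; ring.
Qed.

End WeightTraces.
End Criterion.

Section LieSpan.
Variables (K : fieldType) (L : lieAlgType K).

Lemma lie_span_le (U V W : {vspace L}) :
  (forall x y, x \in U -> y \in V -> [lie x, y] \in W) -> (lie_span U V <= W)%VS.
Proof.
move=> h; apply/span_subvP => _ /allpairsP[[x y] [/= xU yV ->]].
by apply: h; apply: vbasis_mem.
Qed.

End LieSpan.

(** * Cartan's criterion and nondegeneracy of the Killing form *)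

Section CartanCriterion.
Variables (K : closedFieldType) (charK0 : [pchar K] =i pred0) (g : lieAlgType K).
Implicit Types (x y z h v c a b : g) (s t mu nu : K) (U V W H A B L D : {vspace g}).
Local Notation n := (vector.dim g).

Lemma vbasis_span_lie U V (P : g -> Prop) : P 0 ->
  (forall t x y, P x -> P y -> P (t *: x + y)) ->
  (forall x y, x \in U -> y \in V -> P [lie x, y]) ->
  forall v, v \in lie_span U V -> P v.
Proof.
move=> P0 Plin PUV v /(@coord_span _ _ _ (in_tuple _)) ->; apply: (big_ind P) => // [x y Px Py|i _].
  by rewrite -[x]scale1r; apply: Plin.
rewrite -[_ *: _]addr0; apply: Plin => //.
have /allpairsP[[x y] [/= xU yV ->]] := mem_nth 0 (ltn_ord i).
by apply: PUV; apply: vbasis_mem.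
Qed.

(** For a maximal proper [ad D]-stable subspace [U], Engel's theorem gives [v] outside [U] with
    [[D, v]] inside [U]. Maximality makes [U + <[v]>] all of [D], so [[D, D]] lies in [U]. *)
Lemma nil_family_not_perfect D : lie_closed D -> nil_family D -> (D <= lie_span D D)%VS -> D = 0%VS.
Proof.
move=> clD nilD perf; apply/eqP; apply/negPn/negP => D0.
pose P k := `[< exists U, [/\ (U <= D)%VS, ~~ (D <= U)%VS, \dim U = k &
   forall a u, a \in D -> u \in U -> [lie a, u] \in U] >].
have exP : exists k, P k.
  exists 0%N; apply/asboolP; exists 0%VS; split; rewrite ?sub0v ?dimv0 ?subv0 //.
  by move=> a u _; rewrite !memv0 => /eqP ->; rewrite lie0r.
have ubP k : P k -> (k <= \dim D)%N by move=> /asboolP[U [UD _ <- _]]; apply: dimvS.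
case: (ex_maxnP exP ubP) => k /asboolP[U [UD DU dU Ust]] maxk.
have [|v [vD vU Dv]] := engel clD clD Ust DU _ nilD.
  by move=> a w aD wD; have /gew0P[i e] := nilD a w aD wD; exists i; rewrite e mem0v.
have sU : (U <= U + <[v]>)%VS := addvSl _ _.
have : P (\dim (U + <[v]>)%VS) \/ (D <= U + <[v]>)%VS.
  have [le|nle] := boolP (D <= U + <[v]>)%VS; [by right | left].
  apply/asboolP; exists (U + <[v]>)%VS; split=> //; first by rewrite subv_add UD -memvE.
  move=> a _ aD /memv_addP[u uU [_ /vlineP[t ->] ->]].
  by apply: (subvP sU); rewrite lieDr lieZr rpredD ?rpredZ ?Dv ?Ust.
case=> [/maxk le|le].
  have : U = (U + <[v]>)%VS by apply/eqP; rewrite eqEdim sU dU.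
  by move=> e; case/negP: vU; rewrite e memvE addvSr.
case/negP: DU; apply: subv_trans perf _; apply: lie_span_le => x y xD.
move=> /(subvP le) /memv_addP[u uU [_ /vlineP[t ->] ->]].
by rewrite lieDr lieZr rpredD ?rpredZ ?Dv ?Ust.
Qed.

(* Cartan's criterion. For [c = [lie x, y]] with [x], [y] of opposite weights, the
   trace of [ad c] on a weight string vanishes, so all weights take rational
   multiples of one value at [c], and [kf c c = 0] is a sum of squares. *)
Lemma perfect_null D : lie_closed D -> (D <= lie_span D D)%VS ->
  (forall x y, x \in D -> y \in D -> kf x y = 0) -> D = 0%VS.
Proof.
move=> clD perf null; have [h0 h0D reg] := regular_element clD.
pose H := fitting h0 D; have HP v := fittingP h0 D v.
have nilH : nil_family H by move=> c b /HP[hc cD] /HP[hb bD]; apply: reg.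
have h0H : h0 \in H by apply/HP; split=> //; apply: gew_self.
have [h [wt wd]] := weights charK0 nilH.
have hH := wd_in wd; have hD : h \in D by case/HP: hH.
have gewH c : c \in D -> gew h 0 c -> c \in H.
  by move=> cD hc; apply/HP; split=> //; apply: wd_gew wd _ hc _ h0H.
have pjD mu v : v \in D -> pj h mu v \in D by apply: gew_sub => u; apply: clD.
pose Z c := forall nu, prj (adm h) nu != 0 -> wt nu c = 0.
have Zlin t x y : Z x -> Z y -> Z (t *: x + y).
  by move=> Zx Zy nu p0; rewrite (wd_lin wd) Zx // Zy // mulr0 addr0.
have Z0 : Z 0 by move=> nu _; apply: wd_wt0 wd _.
have Zsum (I : eqType) (r : seq I) (F : I -> g) : (forall i, Z (F i)) -> Z (\sum_(i <- r) F i).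
  move=> ZF; apply: (big_ind Z) => // x y Zx Zy.
  by rewrite -[x]scale1r; apply: Zlin.
have Zlie mu x y : x \in D -> y \in D -> gew h mu x -> gew h (- mu) y -> Z [lie x, y].
  move=> xD yD hx hy; have cH : [lie x, y] \in H.
    by apply: gewH; [apply: clD | rewrite -(subrr mu); apply: gew_lie].
  have [p0|pmu] := eqVneq (prj (adm h) mu) 0.
    suff -> : x = 0 by rewrite lie0l.
    by move/gewP: hx => <-; apply: v2r_inj; rewrite v2r_pj p0 mulmx0 linear0.
  have [mu0|mu0] := eqVneq mu 0.
    rewrite mu0 oppr0 in hx hy; move=> nu pnu.
    have [xH yH] := (gewH x xD hx, gewH y yD hy).
    have : \tr (prj (adm h) nu *m adm [lie x, y]) = 0.
      rewrite adm_lie mulmxBr linearB /= mulmxA (adm_shift0 _ hy) -mulmxA mxtrace_mulC.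
      by rewrite -mulmxA subrr.
    rewrite (wd_tr nilH wd) // => /eqP; rewrite mulf_eq0 mxrank_tr_eq0 ?prj_idem //.
    by rewrite (negPf pnu) orbF => /eqP.
  set c := [lie x, y] in cH *.
  have str nu : prj (adm h) nu != 0 -> exists (N : nat) (Z : int),
      (0 < N)%N /\ N%:R * wt nu c = Z%:~R * wt mu c.
    by move=> pnu; apply: (weight_string charK0 nilH wd mu0 hx hy cH pmu pnu).
  have [a0|a0] := eqVneq (wt mu c) 0.
    move=> nu /str[N [Y [N0 /eqP]]]; rewrite a0 mulr0 mulf_eq0 natr0 //.
    by rewrite eqn0Ngt N0 => /eqP.
  set a := wt mu c in str a0.
  (* Division by [a] makes the weights rational at [c], so every term is a nonnegative rational. *)
  pose F nu := (wt nu c / a) ^+ 2 * \tr (prj (adm h) nu).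
  have qF nu : qpos (F nu).
    have [p0|pnu] := eqVneq (prj (adm h) nu) 0.
      by exists 1%N, 0%N; rewrite /F p0 mxtrace0 !mulr0.
    have [N [Y [N0 e]]] := str nu pnu.
    exists (N * N)%N, (`|Y| * `|Y| * \rank (prj (adm h) nu))%N.
    rewrite muln_gt0 N0 /F mxtrace_prj; split=> //.
    have {e} : N%:R * (wt nu c / a) = Y%:~R by rewrite mulrA e mulfK.
    set w := wt nu c / a => e; rewrite !natrM.
    have -> : `|Y|%N%:R * `|Y|%N%:R = Y%:~R * Y%:~R :> K.
      case: (Y) => k //=; rewrite NegzE mulrNz mulrNN //.
    by rewrite -e; ring.
  have sumF : \sum_(nu <- spec (adm h)) F nu = 0.
    transitivity (a ^- 2 * kf c c).
      rewrite (wd_kf nilH wd) // mulr_sumr; apply: eq_bigr => nu _.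
      by rewrite /F expr_div_n mulrCA mulrA [_ * a ^- 2]mulrC.
    by rewrite null ?mulr0 //; case/HP: cH.
  move=> nu pnu; have nus : nu \in spec (adm h).
    by apply: contraT => /prj_out e; rewrite e eqxx in pnu.
  have := qpos_sum0 charK0 (fun i _ => qF i) sumF nus => /eqP.
  rewrite mulf_eq0 mxrank_tr_eq0 ?prj_idem // (negPf pnu) orbF sqrf_eq0 mulf_eq0.
  by rewrite invr_eq0 (negPf a0) orbF => /eqP.
(* As [D] is perfect, brackets of weight vectors suffice, and only opposite weights contribute to
   the zero component. *)
have ZD v : v \in D -> Z (pj h 0 v).
  move=> /(subvP perf); move: v; apply: vbasis_span_lie.
  - by rewrite linear0.
  - by move=> t x y; rewrite linearP; apply: Zlin.
  move=> x y xD yD; rewrite [x](pj_sum h) lie_suml linear_sum /=; apply: (Zsum) => mu.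
  rewrite [y](pj_sum h) lie_sumr linear_sum /=; apply: (Zsum) => nu.
  have xm := pj_gew h mu x; have yn := pj_gew h nu y.
  have xy := gew_lie xm yn; have [e|ne] := eqVneq (mu + nu) 0.
    rewrite e in xy; move/gewP: xy => ->; apply: (Zlie mu); rewrite ?pjD //.
    by move/eqP: e; rewrite addrC addr_eq0 => /eqP <-.
  by rewrite (pj_neq xy ne).
have ZH c : c \in H -> Z c.
  move=> cH; have /gewP <- : gew h 0 c by apply: nilH.
  by apply: ZD; case/HP: cH.
(* Weights are labelled by their values at [h], and these now all vanish; so 0 is the only
   eigenvalue and [D] is a nil family. *)
have prj1 nu : nu != 0 -> prj (adm h) nu = 0.
  move=> nu0; apply/eqP; apply/negPn/negP => pnu; case/negP: nu0.
  by rewrite -(wd_h wd pnu) (ZH _ hH).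
have all0 v : gew h 0 v.
  apply/gewP; rewrite [RHS](pj_sum h); apply: v2r_inj; rewrite v2r_pj -prj_pick linear_sum.
  apply: eq_bigr => nu _; rewrite /= v2r_pj; case: eqVneq => // nu0.
  by rewrite prj1 // mulmx0.
apply: nil_family_not_perfect => // c b cD bD.
by apply: nilH; apply: gewH.
Qed.

(** The decreasing derived series stabilises, and its stable term is perfect. *)
Lemma derived_core W : lie_closed W ->
  (forall k, iter k (fun V => lie_span V V) W != 0%VS) ->
  exists D, [/\ lie_closed D, (D <= W)%VS, D != 0%VS & (D <= lie_span D D)%VS].
Proof.
have [N] := ubnP (\dim W); elim: N W => // N IHN W lt clW nz.
have sub : (lie_span W W <= W)%VS by apply: lie_span_le.
have [le|nle] := boolP (W <= lie_span W W)%VS; first by exists W; split=> //; apply: (nz 0%N).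
have [||k|D [clD DW D0 pD]] := IHN (lie_span W W).
- rewrite -ltnS; apply: leq_trans lt; rewrite ltnS ltnNge; apply: contra nle => le.
  by have /eqP -> : lie_span W W == W by rewrite eqEdim sub.
- by move=> x y /(subvP sub) xW /(subvP sub) yW; apply: memv_lie_span.
- by rewrite -iterSr; apply: nz.
by exists D; split=> //; apply: subv_trans DW sub.
Qed.

Definition kfl x : 'Hom(g, K^o) := linfun (kf x : g -> K^o).

Fact kf_is_linear x : linear (kf x : g -> K^o). Proof. by move=> t y z; rewrite kf_linearr. Qed.
HB.instance Definition _ x := GRing.isLinear.Build K g K^o _ (kf x : g -> K^o) (kf_is_linear x).

Lemma kflE x y : kfl x y = kf x y. Proof. exact: lfunE. Qed.

Lemma kfl_linear : linear kfl.
Proof.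
by move=> t x y; apply/lfunP => z; rewrite add_lfunE scale_lfunE !kflE kf_linearl.
Qed.
HB.instance Definition _ := GRing.isLinear.Build K g 'Hom(g, K^o) _ kfl kfl_linear.

Lemma mem_ker_kfl x : reflect (forall y, kf x y = 0) (x \in lker (linfun kfl)).
Proof.
rewrite memv_ker lfunE /=; apply: (iffP eqP) => [/lfunP e y | e].
  by rewrite -kflE e zero_lfunE.
by apply/lfunP => y; rewrite zero_lfunE kflE e.
Qed.

(** The radical of [kf] is an ideal. Were it not solvable, its derived core would be a nonzero
    perfect subalgebra on which [kf] vanishes, against [perfect_null]. *)
Lemma killing_nondeg : lie_semisimple g -> forall x, (forall y, kf x y = 0) -> x = 0.
Proof.
move=> ss x kx; pose S := lker (linfun kfl).
have SP v : reflect (forall y, kf v y = 0) (v \in S) by apply: mem_ker_kfl.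
have iS : lie_ideal S.
  by move=> u v /SP kv; apply/SP => y; rewrite lieC kfNl kf_inv kv oppr0.
suff S0 : S = 0%VS by apply/eqP; rewrite -memv0 -S0; apply/SP.
apply: ss => //; apply: contrapT => nsol.
have [||D [clD DS D0 pD]] := @derived_core S.
- by move=> u v _ vS; apply: iS.
- by move=> k; apply/eqP => e; apply: nsol; exists k.
case/negP: D0; apply/eqP/perfect_null => // u v uD _.
by have /SP := subvP DS _ uD.
Qed.

Lemma riesz (xi : 'Hom(g, K^o)) : (forall x, (forall y, kf x y = 0) -> x = 0) ->
  exists b, forall y, xi y = kf b y.
Proof.
move=> nd; have k0 : lker (linfun kfl) == 0%VS.
  rewrite -subv0; apply/subvP => x /mem_ker_kfl/nd ->; exact: mem0v.
have : xi \in limg (linfun kfl).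
  suff -> : limg (linfun kfl) = fullv by rewrite memvf.
  apply/eqP; rewrite eqEdim subvf /= limg_dim_eq ?(eqP k0) ?capv0 //.
  by rewrite !dimvf /dim /= muln1.
by move=> /memv_imgP[b _ ->]; exists b => y; rewrite lfunE /= kflE.
Qed.

End CartanCriterion.

(** * Cartan subalgebras *)

Section CartanLike.
Variables (K : closedFieldType) (charK0 : [pchar K] =i pred0) (g : lieAlgType K).
Implicit Types (x y z h v c a b : g) (s t mu nu : K) (U V W H A B L D q : {vspace g}).
Local Notation n := (vector.dim g).

Lemma kf_gew h mu nu x y : gew h mu x -> gew h nu y -> mu + nu != 0 -> kf x y = 0.
Proof.
move=> hx hy mn; rewrite /kf -[adm x *m _]mul1mx -(prj_sum (adm h)) mulmx_suml linear_sum.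
apply: big1 => la _ /=; rewrite -prj_idem -!mulmxA [prj _ _ *m (adm x *m _)]mulmxA.
rewrite (adm_shift _ hx) -mulmxA (adm_shift _ hy) mulmxA mulmxA mxtrace_mulC !mulmxA.
rewrite prj_orth ?mul0mx ?mxtrace0 //.
by rewrite -addrA -{2}[la]addr0 (inj_eq (addrI la)).
Qed.

Definition kf_nondeg q : Prop := forall x, x \in q -> (forall y, y \in q -> kf x y = 0) -> x = 0.

Definition centv q x : {vspace g} := (q :&: lker (adl x))%VS.

Lemma centvP q x v : reflect (v \in q /\ [lie x, v] = 0) (v \in centv q x).
Proof.
by rewrite memv_cap memv_ker adlE; apply: (iffP andP) => -[vq /eqP].
Qed.

Lemma mem_vs2mx U v : (v \in U) = (v2r v <= vs2mx U)%MS.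
Proof. by rewrite -genmxE. Qed.

Lemma vs2mx_subP U V : reflect (forall v, v \in U -> v \in V) (vs2mx U <= vs2mx V)%MS.
Proof. exact: subvP. Qed.

Lemma dim_centv q x : (\dim (centv q x) + \rank (vs2mx q *m adm x))%N = \dim q.
Proof.
rewrite -[RHS](limg_ker_dim (adl x) q); congr (_ + _)%N.
have -> : (adl x @: q)%VS = mx2vs (vs2mx q *m adm x) by rewrite /adm; move: (adl x) => f; rewrite unlock.
by rewrite /dimv mxrank_gen.
Qed.

Definition ptr_mx (N : nat) (x : g) : 'M[K]_(n, N) :=
  \matrix_(i, k) \tr (adm x ^+ k *m adm (r2v (delta_mx 0 i))).

Lemma ptr_mxE N x y (k : 'I_N) : (v2r y *m ptr_mx N x) 0 k = \tr (adm x ^+ k *m adm y).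
Proof.
have yE : y = \sum_i v2r y 0 i *: r2v (delta_mx 0 i).
  apply: v2r_inj; rewrite linear_sum [LHS]row_sum_delta; apply: eq_bigr => i _.
  by rewrite /= v2rZ r2vK.
rewrite mxE; have -> : adm y = \sum_i v2r y 0 i *: adm (r2v (delta_mx 0 i)).
  by rewrite {1}yE linear_sum; apply: eq_bigr => i _; rewrite linearZ.
rewrite mulmx_sumr linear_sum; apply: eq_bigr => i _.
by rewrite mxE -scalemxAr linearZ.
Qed.

Definition ptr_line N x y : 'M[{poly K}]_(n, N) :=
  \matrix_(i, k) \tr (linemx (adm x) (adm y) ^+ k *m map_mx polyC (adm (r2v (delta_mx 0 i)))).

Lemma ev_ptr_line N x y t : evmx t (ptr_line N x y) = ptr_mx N (x + t *: (y - x)).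
Proof.
apply/matrixP => i k; rewrite !mxE adm_line -[in RHS](evmxC t (adm (r2v _))) -evmxX.
by rewrite -evmxM /evmx trace_map_mx.
Qed.

(* The functionals [y |-> tr (ad x ^+ k *m ad y)] vanish on [lie x, q]. *)
Lemma rank_ptr_le N q x : lie_closed q -> x \in q ->
  (\rank (vs2mx q *m ptr_mx N x) <= \dim (centv q x))%N.
Proof.
move=> clq xq; rewrite -(leq_add2r (\rank (vs2mx q *m adm x))) dim_centv.
rewrite -[leqRHS](mxrank_mul_ker (vs2mx q) (ptr_mx N x)) leq_add2l mxrankS //.
apply/rV_subP => w /submxP[u ->]; rewrite mulmxA sub_capmx.
set v := r2v (u *m vs2mx q); have uE : u *m vs2mx q = v2r v by rewrite r2vK.
have vq : v \in q by rewrite mem_vs2mx -uE submxMl.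
rewrite uE v2r_adm -mem_vs2mx clq //=; apply/sub_kermxP/rowP => k; rewrite ptr_mxE mxE.
rewrite adm_lie mulmxBr linearB /= mulmxA mxtrace_mulC !mulmxA -[_ *m _ ^+ k]exprS.
by rewrite -[_ ^+ k *m _]exprSr subrr.
Qed.

(* For [kf]-nondegenerate [q] the functionals of [ptr_mx] at a generic element of
   [H] separate the points of [H], and this persists generically on the line
   from any [x] to that element; this is the lower bound for [\dim (centv q x)]. *)
Lemma cartan_like q H : lie_closed q -> kf_nondeg q -> (H <= q)%VS -> nil_family H ->
  (forall v, v \in q -> (forall c, c \in H -> gew c 0 v) -> v \in H) ->
  [/\ forall c b, c \in H -> b \in H -> [lie c, b] = 0,
      forall c, c \in H -> (forall b, b \in H -> kf c b = 0) -> c = 0,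
      forall x, x \in q -> (\dim H <= \dim (centv q x))%N &
      exists h, [/\ h \in H, forall v, v \in q -> gew h 0 v -> v \in H &
        forall v, gew h 0 v -> forall c, c \in H -> gew c 0 v]].
Proof.
move=> clq ndq /subvP Hq nilH zero.
have [h [wt wd]] := weights charK0 nilH; have hH := wd_in wd; have hq := Hq h hH.
have gewH v : v \in q -> gew h 0 v -> v \in H.
  by move=> vq hv; apply: zero => // c cH; apply: wd_gew wd _ hv _ cH.
have ndH : kf_nondeg H.
  move=> c cH kc; apply: ndq => [|v vq]; first exact: Hq.
  rewrite [v](pj_sum h) kf_sumr big1 // => mu _.
  have hc : gew h 0 c by apply: nilH.
  have [->|mu0] := eqVneq mu 0; last by apply: kf_gew hc (pj_gew _ _ _) _; rewrite add0r.
  apply/kc/gewH; last exact: pj_gew.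
  by apply: gew_sub => // u uq; apply: clq.
(* These traces are weights times multiplicities, so all weights vanish at [c] and [c] is in the
   radical of [kf] on [H]. *)
have w0 c : c \in H -> (forall mu, \tr (prj (adm h) mu *m adm c) = 0) -> c = 0.
  move=> cH tr0; apply: ndH => // b bH; apply: (wd_wt_kf0 charK0 nilH wd) => // mu pmu.
  have /eqP := tr0 mu; rewrite (wd_tr nilH wd) // mulf_eq0 mxrank_tr_eq0 ?prj_idem //.
  by rewrite (negPf pmu) orbF => /eqP.
split=> //.
- move=> c b cH bH; apply: w0 => [|mu].
    apply: zero => [|a aH]; first by apply: clq; apply: Hq.
    by rewrite -[0]addr0; apply: gew_lie; apply: nilH.
  rewrite adm_lie mulmxBr linearB /= mulmxA (wd_comm nilH wd) // -mulmxA mxtrace_mulC.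
  by rewrite -mulmxA subrr.
- move=> x xq; pose N := spec_deg (adm h); pose E := vs2mx q.
  have rkh : (\dim H <= \rank (E *m ptr_mx N h))%N.
    have HE : (vs2mx H <= E)%MS by apply/vs2mx_subP.
    apply: leq_trans (mxrankS (submxMr _ HE)).
    rewrite /dimv -(mxrank_mul_ker (vs2mx H) (ptr_mx N h)).
    suff -> : (vs2mx H :&: kermx (ptr_mx N h))%MS = 0 by rewrite mxrank0 addn0.
    apply/eqP; rewrite -submx0; apply/rV_subP => w; rewrite sub_capmx submx0.
    rewrite -[w]r2vK -mem_vs2mx; set c := r2v w => /andP[cH /sub_kermxP ck].
    apply/eqP; rewrite (w0 c) ?linear0 // => mu.
    have [co ->] := prj_powers (adm h) mu; rewrite mulmx_suml linear_sum big1 //= => k _.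
    rewrite -scalemxAl linearZ /= -(ptr_mxE h c k).
    by rewrite ck mxE mulr0.
  (* A generic [y] on the line has trace functionals of rank at least that at [h], the value at 1,
     and [ad y] has rank on [q] at least that of [ad x], the value at 0. *)
  have cof1 := cofin_rank (map_mx polyC E *m ptr_line N x h) 1.
  have cof2 := cofin_rank (map_mx polyC E *m linemx (adm x) (adm h)) 0.
  have [t []] := cofin_ex (cofin_and cof1 cof2).
  rewrite !evmxM !evmxC !ev_ptr_line -!adm_line scale1r [x + (h - x)]addrC subrK scale0r addr0.
  set y := x + _ => r1 r2; have yq : y \in q by rewrite rpredD ?rpredZ ?rpredB.
  apply: leq_trans (leq_trans rkh r1) _; apply: leq_trans (rank_ptr_le _ clq yq) _.
  by rewrite -(leq_add2r (\rank (E *m adm x))) dim_centv -(dim_centv q y) leq_add2l.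
- by exists h; split=> // v hv c cH; apply: wd_gew wd _ hv _ cH.
Qed.

End CartanLike.

Section CartanSubalgebras.
Variables (K : fieldType) (L : lieAlgType K).

Lemma nilpotent_iter (H : {vspace L}) : lie_nilpotent H ->
  exists k, forall c b, c \in H -> b \in H -> iter k (lie_bracket c) b = 0.
Proof.
move=> [k Hk]; exists k => c b cH bH; apply/eqP; rewrite -memv0 -Hk.
by elim: k {Hk} => //= k IHk; apply: memv_lie_span.
Qed.

Lemma abelian_nilpotent (H : {vspace L}) :
  (forall c b, c \in H -> b \in H -> [lie c, b] = 0) -> lie_nilpotent H.
Proof.
move=> ab; exists 1%N; apply/eqP; rewrite /= -subv0; apply: lie_span_le => x y xH yH.
by rewrite ab ?mem0v.
Qed.

Lemma lie_rankP : (exists H : {vspace L}, cartan_subalgebra H) ->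
  exists2 H : {vspace L}, cartan_subalgebra H & \dim H = lie_rank L.
Proof.
move=> exH; pose P : set {vspace L} := [set H : {vspace L} | cartan_subalgebra H]%classic.
by exists (xget 0%VS P) => //; exact: (@xgetPex _ _ P exH).
Qed.

End CartanSubalgebras.

Section Cartan.
Variables (K : closedFieldType) (charK0 : [pchar K] =i pred0) (g : lieAlgType K).
Implicit Types (x y z h v c a b : g) (s t mu nu : K) (U V W H A B L D q : {vspace g}).

(* What is used of a Cartan subalgebra [H] of [q]: [H] contains its zero weight
   space in [q]. *)
Definition cartan_in q H : Prop := [/\ (H <= q)%VS, nil_family H &
  forall v, v \in q -> (forall c, c \in H -> gew c 0 v) -> v \in H].

(** If the Fitting null space of a generic [h] exceeded [H], Engel's theorem for [H] acting on it
    modulo [H] would give an element outside [H] normalising [H]. *)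
Lemma cartan_in_normalizer q H : lie_closed q -> lie_closed H -> (H <= q)%VS -> nil_family H ->
  (forall x, x \in q -> (forall h, h \in H -> [lie x, h] \in H) -> x \in H) -> cartan_in q H.
Proof.
move=> clq clH /subvP Hq nilH norm; split=> //; first exact/subvP.
have [h [wt wd]] := weights charK0 nilH; have hH := wd_in wd.
pose W := fitting h q; have WP v := fittingP h q v.
move=> v vq nilv; have vW : v \in W by apply/WP; split=> //; apply: nilv.
suff /subvP WH : (W <= H)%VS by apply: WH.
apply/negPn/negP => WH.
have [||w [/WP[hw wq] wH Hw]] := engel clH _ clH WH _ nilH.
- move=> a w aH /WP[hw wq]; apply/WP; split; last by apply: clq => //; apply: Hq.
  by rewrite -[0]addr0; apply: gew_lie => //; apply: nilH.
- move=> a w aH /WP[hw _].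
  by have /gew0P[i e] := wd_gew wd hw aH; exists i; rewrite e mem0v.
case/negP: wH; apply: norm => // c cH.
by rewrite lieC rpredN Hw.
Qed.

Lemma cartan_in_self q H x : cartan_in q H -> kf_nondeg q -> lie_closed q ->
  x \in q -> (forall h, h \in H -> [lie x, h] \in H) -> x \in H.
Proof.
move=> [Hq nilH zero] nd clq xq xH.
have [ab _ _ [h [hH gH _]]] := cartan_like charK0 clq nd Hq nilH zero.
apply: gH => //; apply/gew0P; exists 2%N => /=.
by apply: ab => //; rewrite lieC rpredN xH.
Qed.

Lemma cartan_in_ex q : lie_closed q -> exists H, cartan_in q H.
Proof.
move=> clq; have [h hq reg] := regular_element clq.
pose H := fitting h q; have HP v := fittingP h q v.
exists H; split; first exact: capvSr.
  by move=> c b /HP[hc cq] /HP[hb bq]; apply: reg.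
move=> v vq hv; apply/HP; split=> //; apply: hv; apply/HP; split=> //.
exact: gew_self.
Qed.

Lemma cartan_in_closed q H : lie_closed q -> kf_nondeg q -> cartan_in q H -> lie_closed H.
Proof.
move=> clq nd [Hq nilH zero] x y xH yH.
have [ab _ _ _] := cartan_like charK0 clq nd Hq nilH zero.
by rewrite ab ?mem0v.
Qed.

(** The existence of some Cartan subalgebra is settled first, because only then is the subspace
    chosen in [lie_rank] known to be one. *)
Lemma rank_full : kf_nondeg {:g} -> exists2 H, cartan_in {:g} H & \dim H = lie_rank g.
Proof.
move=> nd; have clf : lie_closed {:g} by move=> x y _ _; apply: memvf.
have [|H [clH nilH norm] dH] := @lie_rankP _ g.
  have [H cH] := cartan_in_ex clf; exists H; case: (cH) => Hq nilH zero.
  have [ab _ _ _] := cartan_like charK0 clf nd Hq nilH zero.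
  split; [exact: cartan_in_closed cH | exact: abelian_nilpotent | ].
  by move=> x; apply: cartan_in_self cH nd clf (memvf x).
exists H => //; apply: cartan_in_normalizer (subvf _) _ _ => //.
- move=> c b cH bH; have [k hk] := nilpotent_iter nilH.
  by apply/gew0P; exists k; apply: hk.
- by move=> x _; apply: norm.
Qed.

Section Sub.
Variable Q : lieSubalg g.
Local Notation sQ := (subvs_of (lsv Q)).

Lemma vsval_lie (x y : sQ) : vsval [lie x, y] = [lie vsval x, vsval y].
Proof. by []. Qed.

Lemma vsval_iter (x y : sQ) k :
  vsval (iter k (lie_bracket x) y) = iter k (lie_bracket (vsval x)) (vsval y).
Proof. by elim: k => //= k <-. Qed.

(** Transported between [sQ] and subspaces of [g], because [kf] and [gew] refer to the adjoint
    representation of all of [g]. *)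
Lemma rank_sub : kf_nondeg (lsv Q) -> exists2 H, cartan_in (lsv Q) H & \dim H = lie_rank sQ.
Proof.
move=> nd; have clQ := @lsv_closed _ _ Q.
have [|H [clH nilH norm] dH] := @lie_rankP _ sQ.
  have [H cH] := cartan_in_ex clQ; case: (cH) => Hq nilH zero.
  have clH := cartan_in_closed clQ nd cH.
  have [ab _ _ _] := cartan_like charK0 clQ nd Hq nilH zero.
  pose Hs := (linfun (vsproj (lsv Q)) @: H)%VS.
  have HsP (x : sQ) : (x \in Hs) = (vsval x \in H).
    apply/memv_imgP/idP => [[u uH ->]|xH]; rewrite ?lfunE /=.
      by rewrite vsprojK // (subvP Hq).
    by exists (vsval x) => //; rewrite lfunE /= vsvalK.
  exists Hs; split.
  - by move=> x y; rewrite !HsP; apply: clH.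
  - apply: abelian_nilpotent => c b; rewrite !HsP => cH' bH'.
    by apply: subvs_inj; rewrite vsval_lie ab ?linear0.
  - move=> x hx; rewrite HsP; apply: (cartan_in_self cH nd clQ (subvsP x)) => b bH.
    have bQ := subvP Hq _ bH; have := hx (vsproj (lsv Q) b).
    by rewrite !HsP vsval_lie vsprojK //; apply.
pose H' := (linfun (@vsval _ _ (lsv Q)) @: H)%VS.
have H'P u : u \in H' -> exists2 x : sQ, x \in H & u = vsval x.
  by move=> /memv_imgP[x xH ->]; exists x; rewrite ?lfunE.
have memH' (x : sQ) : x \in H -> vsval x \in H'.
  by move=> xH; apply/memv_imgP; exists x; rewrite ?lfunE.
exists H'.
  apply: cartan_in_normalizer => //.
  - by move=> _ _ /H'P[x xH ->] /H'P[y yH ->]; rewrite -vsval_lie; apply/memH'/clH.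
  - by apply/subvP => _ /H'P[x _ ->]; apply: subvsP.
  - move=> _ _ /H'P[x xH ->] /H'P[y yH ->]; have [k hk] := nilpotent_iter nilH.
    by apply/gew0P; exists k; rewrite -vsval_iter hk ?linear0.
  - move=> x xQ hx; rewrite -(vsprojK xQ); apply/memH'/norm => y yH.
    have [z zH e] := H'P _ (hx _ (memH' _ yH)).
    suff -> : [lie vsproj (lsv Q) x, y] = z by [].
    by apply: subvs_inj; rewrite vsval_lie vsprojK.
rewrite -dH; apply: limg_dim_eq; apply/eqP; rewrite -subv0; apply/subvP => x.
by rewrite memv_cap memv_ker lfunE memv0 /= => /andP[_ /eqP e]; apply/eqP/subvs_inj; rewrite e linear0.
Qed.

End Sub.

Lemma cartan_dim_min q H x : lie_closed q -> kf_nondeg q -> cartan_in q H -> x \in q ->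
  (\dim H <= \dim (centv q x))%N.
Proof.
by move=> clq nd [Hq nilH zero]; have [_ _ + _] := cartan_like charK0 clq nd Hq nilH zero; apply.
Qed.

Lemma cartan_dim_reached q H : lie_closed q -> kf_nondeg q -> cartan_in q H ->
  exists2 h, h \in H & centv q h = H.
Proof.
move=> clq nd [Hq nilH zero].
have [ab _ _ [h [hH gH _]]] := cartan_like charK0 clq nd Hq nilH zero.
exists h => //; apply/vspaceP => v; apply/centvP/idP => [[vq hv]|vH].
  by apply: gH => //; apply/gew0P; exists 1%N.
by rewrite ab // (subvP Hq).
Qed.

End Cartan.

(** * Regular elements of the fixed subalgebra *)

(** [k] is the part of [M] prime to [a]: a prime of [M] dividing [a] divides neither [k] nor [b],
    any other divides [k] but not [a], and so none divides [a + k * b]. *)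
Lemma coprime_shift a b M : (0 < a)%N -> (0 < M)%N -> coprime a b ->
  exists k, coprime (a + k * b) M.
Proof.
move=> a0 M0 ab; exists (M`_(\pi(a)^'))%N; rewrite /coprime.
set k := (M`__)%N; apply: contraT => g1.
have g0 : (0 < gcdn (a + k * b) M)%N by rewrite gcdn_gt0 M0 orbT.
have lt1 : (1 < gcdn (a + k * b) M)%N by rewrite ltn_neqAle eq_sym g1.
have pp := pdiv_prime lt1; set p := pdiv _ in pp.
have : (p %| gcdn (a + k * b) M)%N := pdiv_dvd _.
rewrite dvdn_gcd => /andP[ps pM].
have [pa|pa] := boolP (p %| a)%N.
  have : (p %| k * b)%N by rewrite -(dvdn_addr _ pa).
  rewrite Euclid_dvdM // => /orP[pk|pb].
    have k0 : (0 < k)%N := part_gt0 _ _.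
    have /pnatP : (\pi(a)^').-nat k := part_pnat _ _.
    by move=> /(_ k0 p pp pk); rewrite inE /= mem_primes pp a0 pa.
  have : (p %| gcdn a b)%N by rewrite dvdn_gcd pa pb.
  by move/eqP: ab => ->; rewrite dvdn1 => /eqP p1; rewrite p1 in pp.
have pk : (p %| k)%N.
  have <- : (p`_(\pi(a)^'))%N = p.
    by apply: part_pnat_id; rewrite pnatE // inE /= mem_primes pp a0.
  exact: partn_dvd.
by case/negP: pa; rewrite -(dvdn_addl _ (dvdn_mulr b pk)).
Qed.

(** Modulo [m] the multiples of [i] are those of [d = gcdn i m]. If [d] divides [j], degree 0 is
    reached; otherwise [coprime_shift], after division by [gcdn j d], brings the gcd with [m] down
    to [gcdn j d < d]. *)
Lemma orbit_step i j m : (0 < i)%N -> (0 < m)%N -> exists k,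
  (m %| j + k * i)%N \/ (gcdn (j + k * i) m < gcdn i m)%N.
Proof.
move=> i0 m0; case: (egcdnP m i0) => km kn e _; set d := gcdn i m in e *.
have d0 : (0 < d)%N by rewrite gcdn_gt0 i0.
have [/dvdnP[q ->]|dj] := boolP (d %| j)%N.
  (* [m.-1] stands for -1 modulo [m]. *)
  exists (q * m.-1 * km)%N; left; rewrite -mulnA e.
  have -> : (q * d + q * m.-1 * (kn * m + d) = m * (q * m.-1 * kn + q * d))%N.
    by case: (m) m0 => // m1 _ /=; nia.
  exact: dvdn_mulr.
have j0 : (0 < j)%N by case: (j) dj => //; rewrite dvdn0.
pose e0 := gcdn j d; have e00 : (0 < e0)%N by rewrite gcdn_gt0 j0.
have lt : (e0 < d)%N.
  rewrite ltn_neqAle dvdn_leq ?dvdn_gcdr // andbT.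
  by apply: contra dj => /eqP <-; apply: dvdn_gcdl.
have /dvdnP[a ja] : (e0 %| j)%N by apply: dvdn_gcdl.
have /dvdnP[b db] : (e0 %| d)%N by apply: dvdn_gcdr.
have /dvdnP[M mM] : (e0 %| m)%N.
  by apply: dvdn_trans (dvdn_gcdr j d) (dvdn_gcdr i m).
have ab : coprime a b.
  by rewrite /coprime -(eqn_pmul2r e00) mul1n muln_gcdl -ja -db.
have a0 : (0 < a)%N by move: j0; rewrite ja muln_gt0 => /andP[].
have M0 : (0 < M)%N by move: m0; rewrite mM muln_gt0 => /andP[].
have [k /eqP cop] := coprime_shift a0 M0 ab.
exists (k * km)%N; right; rewrite -mulnA e.
have -> : (j + k * (kn * m + d) = k * kn * m + (a + k * b) * e0)%N.
  by rewrite {1}ja {1}db; ring.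
by rewrite gcdnC gcdnMDl {1}mM -muln_gcdl gcdnC cop mul1n.
Qed.

Section FixedPoints.
Variables (K : closedFieldType) (charK0 : [pchar K] =i pred0) (g : lieAlgType K).
Variables (theta : lieAut g) (m : nat) (z : K).
Hypotheses (zP : m.-primitive_root z) (thetaP : lie_aut_order theta m).
Hypothesis nd : forall x : g, (forall y, kf x y = 0) -> x = 0.
Implicit Types (x y h v c a b : g) (s t mu nu : K) (U V W H A B L D q : {vspace g}).
Local Notation n := (vector.dim g).
Local Notation gr i := (grade theta z i).
Local Notation gc i x := (gradecomp theta m z i x).
Local Notation g0 := (lsv (fixed_subalg theta)).

Let m_gt0 : (0 < m)%N. Proof. by case: thetaP. Qed.
Let z_neq0 : z != 0. Proof. by rewrite (prim_root_eq0 zP) -lt0n. Qed.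

Lemma gc_lin i t x y : gc i (t *: x + y) = t *: gc i x + gc i y.
Proof. exact: gradecompP. Qed.
Lemma gcD i x y : gc i (x + y) = gc i x + gc i y.
Proof. by rewrite -{1}[x]scale1r gc_lin scale1r. Qed.
Lemma gc0 i : gc i 0 = 0.
Proof. by apply: (addrI (gc i 0)); rewrite -gcD !addr0. Qed.

Lemma grade_modn i : gr (i %% m) = gr i.
Proof. by rewrite /grade (prim_expr_mod zP). Qed.

Lemma theta_iter_lie k x y : iter k theta [lie x, y] = [lie iter k theta x, iter k theta y].
Proof. by elim: k => //= k ->; rewrite lauf_lie. Qed.

Lemma theta_iter_grade k i x : x \in gr i -> iter k theta x = z ^+ (i * k) *: x.
Proof.
move=> /gradeP tx; elim: k => [|k IHk] /=; first by rewrite muln0 scale1r.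
by rewrite IHk linearZ /= tx scalerA mulnS addnC exprD.
Qed.

Lemma gc_lie i k x v : v \in gr k -> [lie gc i x, v] = gc (i + k) [lie x, v].
Proof.
move=> vk; rewrite /gradecomp lieZl lie_suml; congr (_ *: _); apply: eq_bigr => j _.
rewrite theta_iter_lie (theta_iter_grade _ vk) lieZl lieZr scalerA; congr (_ *: _).
by rewrite mulnDl exprD invfM -mulrA mulVf ?mulr1 // expf_neq0.
Qed.

Lemma adm_theta x : f2mx theta *m adm (theta x) = adm x *m f2mx theta.
Proof.
by apply: v2r_adm_inj => v; rewrite !mulmxA -v2r_hom !v2r_adm -v2r_hom lauf_lie.
Qed.

Lemma f2mx_theta_unit : f2mx theta \in unitmx.
Proof.
rewrite -row_free_unit -kermx_eq0 -submx0; apply/rV_subP => w /sub_kermxP w0.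
suff : r2v w = 0 by move/(congr1 v2r); rewrite r2vK linear0 => ->; apply: sub0mx.
apply/eqP; rewrite -memv0 -(lauf_inj theta) memv_ker; apply/eqP.
by apply: v2r_inj; rewrite v2r_hom r2vK w0 linear0.
Qed.

Lemma kf_theta x y : kf (theta x) (theta y) = kf x y.
Proof.
have E u : adm (theta u) = invmx (f2mx theta) *m adm u *m f2mx theta.
  by rewrite -mulmxA -adm_theta mulKmx ?f2mx_theta_unit.
rewrite /kf !E mxtrace_mulC !mulmxA mulmxK ?f2mx_theta_unit //.
rewrite -!mulmxA mxtrace_mulC -!mulmxA mulmxV ?f2mx_theta_unit // mulmx1.
by rewrite mxtrace_mulC.
Qed.

Lemma kf_grade i j x y : x \in gr i -> y \in gr j -> ~~ (m %| i + j)%N -> kf x y = 0.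
Proof.
move=> /gradeP tx /gradeP ty ij; have := kf_theta x y.
rewrite tx ty kfZl kfZr mulrA -exprD -[RHS]mul1r => /eqP.
rewrite -subr_eq0 -mulrBl mulf_eq0 subr_eq0 -(prim_order_dvd zP) (negPf ij) /=.
by move/eqP.
Qed.

Lemma kf_gc i j x v : x \in gr i -> (j < m)%N -> (m %| i + j)%N -> kf x v = kf x (gc j v).
Proof.
move=> xi jm ij; rewrite -[v in LHS](gradecomp_sum zP thetaP) kf_sumr.
rewrite (bigD1 (Ordinal jm)) //= big1 ?addr0 // => k kj.
apply: (kf_grade xi (gradecomp_mem zP thetaP _ _)).
apply: contra kj => ik; rewrite -val_eqE /=.
move: (dvdn_sub ik ij) (dvdn_sub ij ik); rewrite !subnDl => d1 d2.
rewrite eqn_leq -[(k <= j)%N]subn_eq0 -[(j <= k)%N]subn_eq0.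
have small d : (m %| d)%N -> (d < m)%N -> d = 0%N.
  by move=> /eqP e dm; rewrite -(modn_small dm) e.
have e1 := small _ d1 (leq_ltn_trans (leq_subr _ _) (ltn_ord k)).
have e2 := small _ d2 (leq_ltn_trans (leq_subr _ _) jm).
by apply/andP; split; apply/eqP.
Qed.

(** For [i < m] the outer reduction matters only at [i = 0], whose opposite degree is 0 and not
    [m]. *)
Definition opp_deg i := ((m - i) %% m)%N.

Lemma opp_degP i : (i < m)%N -> (opp_deg i < m)%N /\ (m %| i + opp_deg i)%N.
Proof.
move=> im; rewrite ltn_mod m_gt0; split=> //.
by rewrite /dvdn /opp_deg modnDmr subnKC ?modnn // ltnW.
Qed.

Lemma nd_g0 : kf_nondeg g0.
Proof.
move=> x x0 kx; apply: nd => y; rewrite -(grade0 theta z) in x0.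
rewrite (kf_gc y x0 m_gt0 (dvdn0 m)); apply: kx; rewrite -(grade0 theta z).
exact: gradecomp_mem.
Qed.

(** * Commutativity of the Fitting null space of a generic fixed element *)

Section Centralizer.
Variables (H : {vspace g}) (h0 : g).
Hypotheses (h0H : h0 \in H) (Hg0 : (H <= g0)%VS)
  (abH : forall c b, c \in H -> b \in H -> [lie c, b] = 0)
  (ndH : forall c, c \in H -> (forall b, b \in H -> kf c b = 0) -> c = 0)
  (genH : forall v, v \in g0 -> gew h0 0 v -> v \in H)
  (nilH : forall v, gew h0 0 v -> forall c, c \in H -> gew c 0 v).

Local Notation C v := (gew h0 0 v).

Let Hgr c : c \in H -> c \in gr 0.
Proof. by rewrite (grade0 theta z) => /(subvP Hg0). Qed.

Let C_lie x y : C x -> C y -> C [lie x, y].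
Proof. by move=> hx hy; rewrite -[0]addr0; apply: gew_lie. Qed.

Let C_gc i v : C v -> C (gc i v).
Proof.
have th0 : theta h0 = h0 by apply/fixedSpaceP; apply: (subvP Hg0).
move=> /gew0P[k hk]; apply/gew0P; exists k.
suff -> : iter k (lie_bracket h0) (gc i v) = gc i (iter k (lie_bracket h0) v).
  by rewrite hk gc0.
elim: k {hk} => //= k ->; exact: esym (gradecomp_fixed _ _ _ _ th0).
Qed.

Let C_self c : c \in H -> C c.
Proof. by move=> cH; apply/gew0P; exists 1%N; apply: abH. Qed.

Let C_0 v : v \in gr 0 -> C v -> v \in H.
Proof. by rewrite (grade0 theta z); apply: genH. Qed.

(** Only the zero eigencomponent in the opposite degree of a vector pairs with [x], so nondegeneracy
    on [g] descends to the null space degree by degree. *)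
Let C_nondeg i x : (i < m)%N -> x \in gr i -> C x ->
  (forall y, y \in gr (opp_deg i) -> C y -> kf x y = 0) -> x = 0.
Proof.
move=> im xi Cx kx; apply: nd => v; have [jm ij] := opp_degP im.
have -> : kf x v = kf x (pj h0 0 v).
  rewrite [v in LHS](pj_sum h0) kf_sumr.
  rewrite -[pj h0 0 v]v2rK v2r_pj -prj_pick.
  rewrite linear_sum kf_sumr; apply: eq_bigr => nu _.
  case: eqVneq => [->|nu0]; first by rewrite /= -v2r_pj v2rK.
  rewrite linear0 kf0r; apply: kf_gew Cx (pj_gew _ _ _) _; by rewrite add0r.
rewrite (kf_gc _ xi jm ij); apply: kx; first exact: gradecomp_mem.
by apply: C_gc; apply: pj_gew.
Qed.

(* The Riesz representative [s] of [y |-> tr (S_x ad y)], where [S_x] is the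
   semisimple part of [ad x], commutes with everything on which [ad x] is
   nilpotent; its component of degree [i] turns out to be [x]. *)
Let C_central i x : (i < m)%N -> x \in gr i -> C x -> (forall v, C v -> gew x 0 v) ->
  (forall y, y \in gr (opp_deg i) -> C y -> [lie x, y] = 0) -> forall v, C v -> [lie x, v] = 0.
Proof.
move=> im xi Cx nilx comx; have [jm ij] := opp_degP im; set S := ssmx (adm x).
have xiL : linear (fun v => \tr (S *m adm v) : K^o).
  by move=> t u v; rewrite linearP mulmxDr -scalemxAr linearP.
pose xil : {linear g -> K^o} := HB.pack (fun v => \tr (S *m adm v) : K^o)
  (GRing.isLinear.Build K g K^o _ _ xiL).
have [s sE] := riesz (linfun xil) nd.
have {}sE y : kf s y = \tr (S *m adm y) by rewrite -sE lfunE.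
have sC v : C v -> [lie s, v] = 0.
  move=> Cv; apply: nd => y; rewrite kf_inv sE adm_lie mulmxBr linearB /=.
  have SV : S *m adm v = adm v *m S.
    rewrite /S /ssmx mulmx_suml mulmx_sumr; apply: eq_bigr => mu _.
    by rewrite -scalemxAl -scalemxAr adm_shift0 //; apply: nilx.
  rewrite [S *m (adm v *m _)]mulmxA SV -[adm v *m S *m _]mulmxA.
  by rewrite [\tr (adm v *m _)]mxtrace_mulC -mulmxA subrr.
have Cs : C s by apply/gew0P; exists 1%N; rewrite /= lieC sC ?oppr0 //; apply: gew_self.
(* The null space is graded, so homogeneous [v] suffice, and for these the bracket is a component of
   [[lie s, v]]. *)
have siC v : C v -> [lie gc i s, v] = 0.
  move=> Cv; rewrite -(gradecomp_sum zP thetaP v) lie_sumr big1 // => k _.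
  by rewrite (gc_lie _ _ (gradecomp_mem zP thetaP k v)) sC ?gc0 //; apply: C_gc.
suff -> : x = gc i s by [].
apply/eqP; rewrite -subr_eq0; apply/eqP; apply: (C_nondeg im).
- by rewrite rpredB // gradecomp_mem.
- by apply: gewB => //; apply: C_gc.
move=> y yj Cy; rewrite kfBl.
have -> : kf (gc i s) y = kf s y.
  by rewrite kfC [RHS]kfC; apply/esym/(kf_gc _ yj im); rewrite addnC.
have XY := adm_comm (comx y yj Cy).
rewrite sE /kf -raddfB -mulmxBl.
(* [adm x - S] is nilpotent and commutes with [adm y], because [x] and [y] commute; hence the
   product is nilpotent. *)
apply: (@mxtrace_nil _ _ _ n); rewrite exprMn_comm; last first.
  apply: commr_sym; apply: commrB; first exact: esym XY.
  exact: ssmx_comm (esym XY).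
by rewrite ssmx_nil mul0r.
Qed.

Let C_0central c v : c \in H -> C v -> [lie c, v] = 0.
Proof.
move=> cH; apply: (C_central m_gt0 (Hgr cH) (C_self cH)).
- by move=> u Cu; apply: nilH.
- by rewrite /opp_deg subn0 modnn => y y0 Cy; apply: abH => //; apply: C_0.
Qed.

(** The bracket lies in [H], and by invariance it is orthogonal to [H], which centralises the null
    space. *)
Let C_opp i x y : (i < m)%N -> x \in gr i -> C x -> y \in gr (opp_deg i) -> C y -> [lie x, y] = 0.
Proof.
move=> im xi Cx yj Cy; apply: ndH => [|b bH].
  apply: C_0; last exact: C_lie.
  have [_ /dvdnP[r e]] := opp_degP im.
  have : [lie x, y] \in gr ((i + opp_deg i) %% m) by rewrite grade_modn; apply: (lie_grade xi yj).
  by rewrite e modnMl.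
by rewrite kf_inv lieC C_0central // oppr0 kf0r.
Qed.

(* Induction on [gcdn i m]: by [orbit_step], iterating [ad x] from any degree
   reaches degree [0] or a degree already treated, so [ad x] is nilpotent. *)
Let C_abelian_grade i x : (i < m)%N -> x \in gr i -> C x -> forall v, C v -> [lie x, v] = 0.
Proof.
have [N] := ubnP (gcdn i m); elim: N i x => // N IHN i x lt im xi Cx.
have [i0|i0] := posnP i.
  by rewrite i0 in xi; move=> v; apply: (C_0central (C_0 xi Cx)).
apply: (C_central im xi Cx); last by move=> y; apply: C_opp im xi Cx.
move=> v Cv; rewrite -(gradecomp_sum zP thetaP v).
apply: (big_ind (fun v => gew x 0 v)) => [|u w|j _]; [exact: gew0 | exact: gewD | ].
set w := gc j v; have wj : w \in gr j := gradecomp_mem zP thetaP j v.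
have Cw : C w by apply: C_gc.
(* After [k] steps the iterate already commutes with [x], so one more step gives 0. *)
have [k hk] := orbit_step j i0 m_gt0; apply/gew0P; exists k.+1 => /=.
set u := iter k _ w; have Cu : C u by rewrite /u; elim: (k) => //= r IHr; apply: C_lie.
have uj : u \in gr ((j + k * i) %% m).
  rewrite grade_modn /u; elim: (k) => [|r IHr] /=; first by rewrite addn0.
  by rewrite mulSn addnCA; apply: (lie_grade xi IHr).
rewrite lieC; suff -> : [lie u, x] = 0 by rewrite oppr0.
case: hk => [/eqP d0|ltg].
  by rewrite d0 in uj; apply: (C_0central (C_0 uj Cu) Cx).
apply: (IHN ((j + k * i) %% m)%N) => //; last by rewrite ltn_mod.
by rewrite gcdn_modl; apply: leq_trans ltg _; rewrite -ltnS.
Qed.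

Lemma centralizer_abelian x v : C x -> C v -> [lie x, v] = 0.
Proof.
move=> Cx Cv; rewrite -(gradecomp_sum zP thetaP x) lie_suml big1 // => i _.
by apply: (@C_abelian_grade i) => //; [apply: gradecomp_mem | apply: C_gc].
Qed.

End Centralizer.

Lemma regular_fixed : exists h0, [/\ h0 \in g0,
   \dim (centv g0 h0) = lie_rank (subvs_of g0) & \dim (centv {:g} h0) = lie_rank g].
Proof.
have clg0 := @lsv_closed _ _ (fixed_subalg theta).
have clg : lie_closed {:g} by move=> x y _ _; apply: memvf.
have ndg : kf_nondeg {:g} by move=> x _ kx; apply: nd => y; apply: kx; apply: memvf.
have [H cH dH] := rank_sub charK0 (nd_g0 : kf_nondeg (lsv (fixed_subalg theta))).
case: (cH) => Hg0 nilH zero.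
have [abH ndH _ [h0 [h0H genH nH]]] := cartan_like charK0 clg0 nd_g0 Hg0 nilH zero.
have Cab := centralizer_abelian h0H Hg0 abH ndH genH nH.
exists h0; split; first exact: (subvP Hg0).
  rewrite -dH; congr (\dim _); apply/vspaceP => v; apply/centvP/idP => [[vq hv]|vH].
    by apply: genH => //; apply/gew0P; exists 1%N.
  by rewrite abH // (subvP Hg0).
have [Hg cHg dHg] := rank_full charK0 ndg; rewrite -dHg.
have CP v : gew h0 0 v <-> v \in centv {:g} h0.
  split=> [Cv|/centvP[_ hv]]; last by apply/gew0P; exists 1%N.
  by apply/centvP; split; [exact: memvf | exact: Cab (gew_self h0) Cv].
have cC : cartan_in {:g} (centv {:g} h0).
  split; first exact: subvf.
    by move=> c b /CP Cc /CP Cb; apply/gew0P; exists 1%N; apply: Cab.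
  move=> v _ hv; apply/CP; apply: (hv h0); apply/CP; exact: gew_self.
have [h hH e] := cartan_dim_reached charK0 clg ndg cHg.
(* Both subspaces are Cartan subalgebras and centralisers of single elements, so each bounds the
   other from below. *)
have le1 := cartan_dim_min charK0 clg ndg cC (memvf h); rewrite e in le1.
have le2 := cartan_dim_min charK0 clg ndg cHg (memvf h0).
by apply/eqP; rewrite eqn_leq le1.
Qed.

End FixedPoints.

(** * Indices *)

Section LinearAlgebra.
Variable K : closedFieldType.

Lemma dim_le_inj (V W : vectType K) (f : V -> W) (U : {vspace V}) (U' : {vspace W}) :
  linear f -> (forall u, f u = 0 -> u = 0) -> (forall u, u \in U -> f u \in U') ->
  (\dim U <= \dim U')%N.
Proof.
move=> fL finj fU; pose F : {linear V -> W} := HB.pack f (GRing.isLinear.Build K V W _ f fL).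
have <- : \dim (linfun F @: U)%VS = \dim U.
  apply: limg_dim_eq; apply/eqP; rewrite -subv0; apply/subvP => u.
  by rewrite memv_cap memv_ker lfunE memv0 => /andP[_ /eqP/finj ->].
by apply: dimvS; apply/subvP => _ /memv_imgP[u uU ->]; rewrite lfunE; apply: fU.
Qed.

Lemma dim_prod (V1 V2 : vectType K) (S1 : {vspace V1}) (S2 : {vspace V2})
    (S : {vspace (V1 * V2)%type}) :
  (forall p, p \in S <-> p.1 \in S1 /\ p.2 \in S2) -> \dim S = (\dim S1 + \dim S2)%N.
Proof.
move=> SP; pose f2 : 'Hom((V1 * V2)%type, V2) := linfun snd.
pose f1 : 'Hom((V1 * V2)%type, V1) := linfun fst.
rewrite -(limg_ker_dim f2 S) -(limg_ker_dim f1 (S :&: lker f2)).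
have -> : (S :&: lker f2 :&: lker f1 = 0)%VS.
  apply/eqP; rewrite -subv0; apply/subvP => -[p q].
  rewrite !memv_cap !memv_ker !lfunE memv0 /= => /andP[/andP[_ /eqP ->] /eqP ->].
  exact: eqxx.
rewrite dimv0 add0n.
have -> : (f1 @: (S :&: lker f2))%VS = S1.
  apply/vspaceP => x; apply/memv_imgP/idP => [[p pS ->]|xS]; rewrite ?lfunE /=.
    by move: pS; rewrite memv_cap => /andP[/SP[]].
  exists (x, 0); last by rewrite lfunE.
  rewrite memv_cap memv_ker lfunE /= eqxx andbT; apply/SP; split=> //=; exact: mem0v.
congr (_ + \dim _)%N; apply/vspaceP => x.
apply/memv_imgP/idP => [[p /SP[_ pS] ->]|xS]; rewrite ?lfunE //=.
by exists (0, x); rewrite ?lfunE //; apply/SP; split=> //=; apply: mem0v.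
Qed.

Definition bilinear_form (V : vectType K) (b : V -> V -> K^o) : Prop :=
  (forall x, linear (b x)) /\ (forall y, linear (b^~ y)).

(** Modelled on [lie_stab], for bare bilinear forms: the deformation varies the bracket and keeps
    the functional. *)
Definition form_rad (V : vectType K) (b : V -> V -> K^o) : {vspace V} :=
  lker (linfun (fun x : V => linfun (fun y : V => b x y))).

Section Rad.
Variables (V : vectType K) (b : V -> V -> K^o).
Hypothesis bL : bilinear_form b.

Lemma rad_lfunE x y : linfun (b x) y = b x y.
Proof.
pose F : {linear V -> K^o} := HB.pack (b x) (GRing.isLinear.Build K V K^o _ (b x) (bL.1 x)).
exact: (lfunE F).
Qed.

Lemma rad_linear : linear (fun x : V => linfun (fun y : V => b x y)).
Proof.
move=> t x y; apply/lfunP => u.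
by rewrite add_lfunE scale_lfunE !rad_lfunE; apply: bL.2.
Qed.

Lemma rad_lfun2E x : linfun (fun x : V => linfun (fun y : V => b x y)) x = linfun (b x).
Proof.
pose F : {linear V -> 'Hom(V, K^o)} := HB.pack (fun x : V => linfun (fun y : V => b x y))
  (GRing.isLinear.Build K V 'Hom(V, K^o) _ _ rad_linear).
exact: (lfunE F).
Qed.

Lemma radP x : reflect (forall y, b x y = 0) (x \in form_rad b).
Proof.
rewrite memv_ker rad_lfun2E; apply: (iffP eqP) => [/lfunP e y|e].
  by rewrite -rad_lfunE e zero_lfunE.
by apply/lfunP => y; rewrite zero_lfunE rad_lfunE.
Qed.

End Rad.

Lemma dim_lker_rank (V W : vectType K) (f : 'Hom(V, W)) :
  (\dim (lker f) + \rank (f2mx f))%N = vector.dim V.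
Proof.
rewrite /lker /dimv mxrank_gen mxrank_ker subnK //.
exact: rank_leq_row.
Qed.

Lemma f2mx_lincomb (V W : vectType K) (f h : 'Hom(V, W)) (c : K) :
  f2mx (f + c *: h) = f2mx f + c *: f2mx h.
Proof.
apply/row_matrixP => i; rewrite !rowE -(r2vK (delta_mx 0 i)) mulmxDr -scalemxAr.
by rewrite -!v2r_hom add_lfunE scale_lfunE linearD linearZ.
Qed.

(** Semicontinuity of the rank read on radicals; [0 < k] makes the form at [t = 0] equal to [b0]. *)
Lemma cofin_rad (V : vectType K) (b0 b1 : V -> V -> K^o) k :
  bilinear_form b0 -> bilinear_form b1 -> (0 < k)%N ->
  cofin (fun t : K => (\dim (form_rad (fun x y => b0 x y + t ^+ k *: b1 x y)%R) <= \dim (form_rad b0))%N).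
Proof.
move=> L0 L1 k0; set f0 := linfun (fun x : V => linfun (fun y : V => b0 x y)).
set f1 := linfun (fun x : V => linfun (fun y : V => b1 x y)).
pose M := map_mx polyC (f2mx f0) + 'X^k *: map_mx polyC (f2mx f1).
have ME t : evmx t M = f2mx (f0 + t ^+ k *: f1).
  rewrite f2mx_lincomb; apply/matrixP => i j.
  by rewrite !mxE /horner_eval !hornerE ?hornerXn.
apply: cofin_imp (cofin_rank M 0) => t.
rewrite !ME expr0n eqn0Ngt k0 scale0r addr0 => le.
have -> : form_rad (fun x y => b0 x y + t ^+ k *: b1 x y) = lker (f0 + t ^+ k *: f1).
  have Lt : bilinear_form (fun x y => b0 x y + t ^+ k *: b1 x y).
    split=> u c v w; rewrite ?L0.1 ?L1.1 ?L0.2 ?L1.2.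
      by rewrite !scalerDr !scalerA addrACA [c * _]mulrC.
    by rewrite !scalerDr !scalerA addrACA [c * _]mulrC.
  congr lker; apply/lfunP => x; rewrite rad_lfun2E // add_lfunE scale_lfunE !rad_lfun2E //.
  by apply/lfunP => y; rewrite add_lfunE scale_lfunE (rad_lfunE Lt) (rad_lfunE L0) (rad_lfunE L1).
have e := etrans (dim_lker_rank f0) (esym (dim_lker_rank (f0 + t ^+ k *: f1))).
by rewrite -(leq_add2r (\rank (f2mx f0))) e leq_add2l.
Qed.

Lemma lie_ind_min (L : lieAlgType K) (xi : 'Hom(L, K^o)) : (lie_ind L <= \dim (lie_stab xi))%N.
Proof.
rewrite /lie_ind; case: ex_minnP => k _; apply; apply/asboolP.
by exists xi.
Qed.

Lemma lie_ind_ex (L : lieAlgType K) : exists xi : 'Hom(L, K^o), \dim (lie_stab xi) = lie_ind L.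
Proof. by rewrite /lie_ind; case: ex_minnP => k /asboolP[xi <-] _; exists xi. Qed.

End LinearAlgebra.

(** * Index of the direct sum, and the upper bound for the semidirect product *)

Section Index.
Variables (K : closedFieldType) (charK0 : [pchar K] =i pred0) (g : lieAlgType K).
Variables (theta : lieAut g) (m : nat) (z : K).
Hypotheses (zP : m.-primitive_root z) (thetaP : lie_aut_order theta m).
Hypothesis nd : forall x : g, (forall y, kf x y = 0) -> x = 0.
Implicit Types (x y h v c a b : g) (t mu nu : K).
Local Notation gr i := (grade theta z i).
Local Notation gc i x := (gradecomp theta m z i x).
Local Notation cb x y := (contraction_bracket theta m z x y).
Local Notation g0 := (lsv (fixed_subalg theta)).
Local Notation L0 := (subvs_of (lsv (fixed_subalg theta))).
Local Notation P := (L0 * g)%type.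
Local Notation Sd := (semidirect (ad_action zP thetaP)).

Let m_gt0 : (0 < m)%N. Proof. by case: thetaP. Qed.
Let clg0 : lie_closed g0. Proof. exact: lsv_closed. Qed.
Let clg : lie_closed {:g}. Proof. by move=> x y _ _; apply: memvf. Qed.
Let ndg0 : kf_nondeg g0. Proof. exact: nd_g0 zP thetaP nd. Qed.
Let ndg : kf_nondeg {:g}.
Proof. by move=> x _ kx; apply: nd => y; apply: kx; apply: memvf. Qed.

Definition lie_hom (L : vectType K) (F : L -> K^o) (FL : linear F) : 'Hom(L, K^o) :=
  linfun (HB.pack F (GRing.isLinear.Build K L K^o _ F FL) : {linear L -> K^o}).

Lemma lie_homE (L : vectType K) (F : L -> K^o) (FL : linear F) (u : L) : lie_hom FL u = F u.
Proof. exact: lfunE. Qed.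

Lemma stab_sum (xi : 'Hom(P, K^o)) a b : a \in g0 ->
  (forall p : P, xi p = kf a (vsval p.1) + kf b p.2) ->
  \dim (lie_stab xi) = (\dim (centv g0 a) + \dim (centv {:g} b))%N.
Proof.
move=> a0 xiE; pose S1 := (linfun (vsproj g0) @: centv g0 a)%VS.
have S1P (s : L0) : (s \in S1) = (vsval s \in centv g0 a).
  apply/memv_imgP/idP => [[u /centvP[ug0 e] ->]|sc]; rewrite ?lfunE /=.
    by rewrite vsprojK //; apply/centvP.
  by exists (vsval s) => //; rewrite lfunE /= vsvalK.
have dS1 : \dim S1 = \dim (centv g0 a).
  apply: limg_dim_eq; apply/eqP; rewrite -subv0; apply/subvP => u.
  rewrite memv_cap memv_ker lfunE memv0 /= => /andP[/centvP[ug0 _] /eqP e].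
  by rewrite -(vsprojK ug0) e linear0.
rewrite -dS1; apply: dim_prod => -[s x] /=; rewrite S1P; split.
  move=> /lie_stabP stab; split; apply/centvP.
    split; first exact: subvsP.
    apply: ndg0 => [|y yg0]; first by apply: clg0 => //; apply: subvsP.
    have := stab (vsproj g0 y, 0); rewrite xiE /= lie0r kf0r addr0 vsprojK //.
    by rewrite -kf_inv.
  split; first exact: memvf.
  apply: nd => y; have := stab (0, y); rewrite xiE /= lie0r kf0r add0r.
  by rewrite -kf_inv.
move=> [/centvP[_ e1] /centvP[_ e2]]; apply/lie_stabP => -[u y].
by rewrite xiE /= -!kf_inv e1 e2 !kf0l addr0.
Qed.

Lemma sum_hom_repr (xi : 'Hom(P, K^o)) : exists a b, a \in g0 /\
  forall p : P, xi p = kf a (vsval p.1) + kf b p.2.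
Proof.
have FL1 : linear (fun v : g => xi (vsproj g0 v, 0) : K^o).
  move=> t u v; rewrite -linearP; congr (xi _); congr pair; rewrite ?linearP //=.
  by rewrite scaler0 addr0.
have FL2 : linear (fun v : g => xi (0, v) : K^o).
  move=> t u v; rewrite -linearP; congr (xi _); congr pair => /=.
  by rewrite scaler0 addr0.
have [a' aE] := riesz (lie_hom FL1) nd; have [b bE] := riesz (lie_hom FL2) nd.
(* Only the degree 0 part of [a'] pairs with the fixed subalgebra, and it lies in it. *)
exists (gc 0 a'), b; split; first by rewrite -(grade0 theta z); apply: gradecomp_mem.
move=> [s x] /=; have sg0 : vsval s \in gr 0 by rewrite (grade0 theta z) subvsP.
have -> : kf (gc 0 a') (vsval s) = kf a' (vsval s).
  by rewrite kfC [RHS]kfC; apply/esym/(kf_gc zP thetaP _ sg0 m_gt0 (dvdn0 m)).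
have e : (s, x) = (s, 0) + (0, x) :> P by congr pair; rewrite /= ?addr0 ?add0r.
by rewrite -aE -bE !lie_homE vsvalK e; apply: (linearD xi).
Qed.

Lemma ind_sum : lie_ind P = (lie_rank L0 + lie_rank g)%N.
Proof.
have [H0 cH0 d0] := rank_sub charK0 (ndg0 : kf_nondeg (lsv (fixed_subalg theta))).
have [Hg cHg dg] := rank_full charK0 ndg.
apply/eqP; rewrite eqn_leq; apply/andP; split.
  have [h0 [h0g e1 e2]] := regular_fixed charK0 zP thetaP nd.
  have FL : linear (fun p : P => kf h0 (vsval p.1) + kf h0 p.2 : K^o).
    move=> t [u x] [v y] /=; rewrite linearP /= !kf_linearr.
    rewrite scalerDr addrACA //.
  apply: leq_trans (lie_ind_min (lie_hom FL)) _.
  by rewrite (stab_sum h0g (lie_homE FL)) e1 e2.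
have [xi <-] := lie_ind_ex P; have [a [b [ag0 xiE]]] := sum_hom_repr xi.
have le1 := cartan_dim_min charK0 clg0 ndg0 cH0 ag0.
have le2 := cartan_dim_min charK0 clg ndg cHg (memvf b).
by rewrite (stab_sum ag0 xiE) -d0 -dg leq_add.
Qed.

Lemma cb_grade j x y : (j < m)%N -> y \in gr j ->
  cb x y = \sum_(i < m | (m <= i + j)%N) [lie gc i x, y].
Proof.
move=> jm yj; rewrite /contraction_bracket [RHS]big_mkcond; apply: eq_bigr => i _ /=.
transitivity (\sum_(k < m) if k == Ordinal jm then (if (m <= i + j)%N then [lie gc i x, y] else 0) else 0).
  rewrite big_mkcond; apply: eq_bigr => k _ /=; rewrite (gradecomp_id zP thetaP _ _ yj) //.
  rewrite -val_eqE /= eq_sym; case: eqVneq => [->//|_].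
  by rewrite lie0r if_same.
by rewrite -big_mkcond big_pred1_eq.
Qed.

(* The functional [kf h0] of the contraction factor, with [h0] in the fixed
   subalgebra regular in both algebras, has a small stabiliser. *)
Lemma ind_tilde_le : (lie_ind Sd <= lie_rank L0 + lie_rank g)%N.
Proof.
have [h0 [h0g e1 e2]] := regular_fixed charK0 zP thetaP nd.
have FL : linear (fun p : P => kf h0 (vsval p.1) + kf h0 p.2 : K^o).
  move=> t [u x] [v y] /=; rewrite linearP /= !kf_linearr.
  by rewrite scalerDr addrACA.
rewrite -e1 -e2 -(stab_sum h0g (lie_homE FL)).
have GL : linear (fun p : Sd => kf h0 (p.2 : g) : K^o).
  by move=> t [u x] [v y] /=; rewrite kf_linearr.
apply: leq_trans (lie_ind_min (lie_hom GL)) _.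
apply: (@dim_le_inj _ _ _ (fun p : Sd => p : P)) => // -[s x].
move=> /lie_stabP stab.
have {}stab (u : L0) (y : g) : kf h0 ([lie vsval s, y] - [lie vsval u, x] + cb x y) = 0.
  by have := stab (u, y); rewrite lie_homE.
have h0gr : h0 \in gr 0 by rewrite (grade0 theta z).
have hs : [lie h0, vsval s] = 0.
  apply: ndg0 => [|y yg0]; first by apply: clg0 => //; apply: subvsP.
  have ygr : y \in gr 0 by rewrite (grade0 theta z).
  have := stab 0 y; rewrite linear0 lie0l subr0 (cb_grade x m_gt0 ygr) big1 ?addr0 ?kf_inv //.
  by move=> i; rewrite addn0 leqNgt ltn_ord.
have st1 y : kf h0 (cb x y) = 0.
  have := stab 0 y; rewrite linear0 lie0l subr0 kfDr -kf_inv hs kf0l add0r //.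
have hx i : (i < m)%N -> [lie h0, gc i x] = 0.
  move=> im; have gix := gradecomp_mem zP thetaP i x.
  have higr : [lie h0, gc i x] \in gr i by have := lie_grade h0gr gix.
  apply: nd => v; have [jm ij] := opp_degP thetaP im.
  rewrite (kf_gc zP thetaP v higr jm ij); set j := opp_deg m i in jm ij *.
  set w := gc j v; have wj : w \in gr j := gradecomp_mem zP thetaP j v.
  (* For [i > 0] one has [i + j = m], so the contraction keeps the bracket of [gc i x] with [w]; for
     [i = 0] it discards it, and [w] is tested in the acting copy of [g_0] instead. *)
  have [i0|i0] := posnP i.
    have j0 : j = 0%N by rewrite /j /opp_deg i0 subn0 modnn.
    have wg0 : w \in g0 by rewrite -(grade0 theta z) -j0.
    have := stab (vsproj g0 w) 0; rewrite lie0r sub0r vsprojK //.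
    have -> : cb x 0 = 0.
      rewrite /contraction_bracket big1 // => k _; rewrite big1 // => l _.
      by rewrite (gc0 theta m z l) lie0r.
    rewrite addr0 -lieC -kf_inv => e.
    have th0 : theta h0 = h0 by apply/fixedSpaceP.
    rewrite i0 -(gradecomp_fixed _ _ _ _ th0) kfC.
    by rewrite -(kf_gc zP thetaP _ (_ : w \in gr 0) m_gt0 (dvdn0 m)) -?j0 // kfC.
  have jE : j = (m - i)%N by rewrite /j /opp_deg modn_small //; lia.
  have := st1 w; rewrite (cb_grade x jm wj) kf_sumr (bigD1 (Ordinal im)) /=; last first.
    by rewrite jE subnKC // ltnW.
  rewrite big1 ?addr0 ?kf_inv // => k /andP[mk ki].
  have := lie_grade (gradecomp_mem zP thetaP k x) wj.
  move=> kj; apply: (kf_grade zP h0gr kj); rewrite add0n.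
  apply: contra ki => /dvdnP[r e]; rewrite -val_eqE /=; apply/eqP.
  have km := ltn_ord k; move: mk e; rewrite jE.
  by case: r => [|[|r]]; rewrite ?mulSn ?mul0n => mk e; lia.
have hx0 : [lie h0, x] = 0.
  rewrite -(gradecomp_sum zP thetaP x) lie_sumr big1 // => i _.
  exact: hx.
apply/lie_stabP => -[u y].
by rewrite lie_homE /= -!kf_inv hs hx0 !kf0l addr0.
Qed.

End Index.

(** * Deformation of the direct sum into the semidirect product *)

Section LowerBound.
Variables (K : closedFieldType) (g : lieAlgType K).
Variables (theta : lieAut g) (m : nat) (z : K).
Hypotheses (zP : m.-primitive_root z) (thetaP : lie_aut_order theta m).
Implicit Types (x y h v c a b : g) (mu nu : K).
Local Notation gr i := (grade theta z i).
Local Notation gc i x := (gradecomp theta m z i x).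
Local Notation cb x y := (contraction_bracket theta m z x y).
Local Notation g0 := (lsv (fixed_subalg theta)).
Local Notation L0 := (subvs_of (lsv (fixed_subalg theta))).
Local Notation P := (L0 * g)%type.
Local Notation Sd := (semidirect (ad_action zP thetaP)).

Lemma interpolate_linear (V : lmodType K) (a c : K) (A B C D : V) :
  a *: A + B + c *: (a *: C + D - (a *: A + B)) = a *: (A + c *: (C - A)) + (B + c *: (D - B)).
Proof.
rewrite opprD addrACA -scalerBr [c *: (_ + _)]scalerDr addrACA [a *: (A + _)]scalerDr.
by rewrite !scalerA [c * a]mulrC.
Qed.

Lemma grade_ext (F : g -> g) : linear F -> (forall i x, (i < m)%N -> x \in gr i -> F x = 0) ->
  forall x, F x = 0.
Proof.
move=> FL F0 x; pose G : {linear g -> g} := HB.pack F (GRing.isLinear.Build K g g _ F FL).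
rewrite -[F]/(G : g -> g) -(gradecomp_sum zP thetaP x) linear_sum big1 // => i _.
by apply: (F0 i) => //; apply: gradecomp_mem.
Qed.

Section Rescaling.
Variable e : nat -> K.

Definition rescale (x : g) : g := \sum_(i < m) e i *: gc i x.

Lemma rescale_linear : linear rescale.
Proof.
move=> t x y; rewrite /rescale scaler_sumr -big_split; apply: eq_bigr => i _ /=.
by rewrite gradecompP scalerDr !scalerA [t * _]mulrC.
Qed.
HB.instance Definition _ := GRing.isLinear.Build K g g _ rescale rescale_linear.

Lemma rescale_grade i x : (i < m)%N -> x \in gr i -> rescale x = e i *: x.
Proof.
move=> im xi; rewrite /rescale (bigD1 (Ordinal im)) //= big1 ?addr0 => [|k].
  by rewrite (gradecomp_id zP thetaP im im xi) eqxx.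
rewrite -val_eqE /= eq_sym => /negPf ki.
by rewrite (gradecomp_id zP thetaP im (ltn_ord k) xi) ki scaler0.
Qed.

Lemma rescale_fixed (s : L0) x : rescale [lie vsval s, x] = [lie vsval s, rescale x].
Proof.
rewrite /rescale lie_sumr; apply: eq_bigr => i _; rewrite lieZr; congr (_ *: _).
by apply: gradecomp_fixed; apply/fixedSpaceP/subvsP.
Qed.

End Rescaling.

Lemma rescaleK (e f : nat -> K) : (forall i, e i * f i = 1) -> forall x, rescale e (rescale f x) = x.
Proof.
move=> ef x; apply/eqP; rewrite -subr_eq0; apply/eqP; move: x.
apply: (@grade_ext (fun x => rescale e (rescale f x) - x)).
  by move=> t x y /=; rewrite linearP /= linearP /= scalerBr opprD addrACA.
move=> i x im xi; rewrite (rescale_grade f im xi) linearZ /= (rescale_grade e im xi).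
by rewrite scalerA mulrC ef scale1r subrr.
Qed.

Variable t : K.
Hypothesis t0 : t != 0.

(* [phi] multiplies degree [i] by [t ^ (m - i)] and carries the bracket of [g] to
   [cb x y + t ^ m (lie x y - cb x y)], which tends to [cb x y] as [t] tends to [0]. *)
Let phi := rescale (fun i => t ^+ (m - i)).
Let psi := rescale (fun i => t ^- (m - i)).

Let phi_lin (a : K) x y : phi (a *: x + y) = a *: phi x + phi y. Proof. exact: rescale_linear. Qed.
Let psi_lin (a : K) x y : psi (a *: x + y) = a *: psi x + psi y. Proof. exact: rescale_linear. Qed.

Let phiK x : psi (phi x) = x.
Proof. by apply: rescaleK => i; rewrite mulVf // expf_neq0. Qed.
Let psiK x : phi (psi x) = x.
Proof. by apply: rescaleK => i; rewrite mulfV // expf_neq0. Qed.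

(** Degree count: [(m - i) + (m - j)] equals [m - (i + j - m)] when [i + j >= m], and exceeds
    [m - (i + j)] by [m] otherwise, so exactly the discarded brackets acquire the factor
    [t ^+ m]. *)
Lemma rescale_bracket x y :
  phi (cb x y + t ^+ m *: ([lie x, y] - cb x y)) = [lie phi x, phi y].
Proof.
apply/eqP; rewrite -subr_eq0; apply/eqP; move: x.
apply: (@grade_ext (fun x => phi (cb x y + t ^+ m *: ([lie x, y] - cb x y)) - [lie phi x, phi y])).
  move=> a x v; rewrite contraction_linearl lie_linearl interpolate_linear !phi_lin.
  by rewrite lie_linearl [a *: (phi _ - _)]scalerBr opprD addrACA.
move=> i x im xi; move: y.
apply: (@grade_ext (fun y => phi (cb x y + t ^+ m *: ([lie x, y] - cb x y)) - [lie phi x, phi y])).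
  move=> a y v; rewrite contraction_linearr lie_linearr interpolate_linear !phi_lin.
  by rewrite lie_linearr [a *: (phi _ - _)]scalerBr opprD addrACA.
move=> j y jm yj; rewrite (contraction_bracketE zP thetaP im jm xi yj).
rewrite [phi x](rescale_grade _ im xi) [phi y](rescale_grade _ jm yj).
rewrite lieZl lieZr scalerA -exprD; apply/eqP; rewrite subr_eq0; apply/eqP.
case: ifP => ij.
  rewrite subrr scaler0 addr0 [phi _](@rescale_grade _ (i + j - m)).
  - by congr (_ *: _); rewrite /=; congr (t ^+ _); lia.
  - lia.
  - exact: lie_grade_mod.
rewrite subr0 add0r [phi _]linearZ /= [rescale _ _](@rescale_grade _ (i + j)).
- by rewrite scalerA -exprD; congr (_ *: _); congr (t ^+ _); lia.
- by rewrite ltnNge ij.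
- exact: lie_grade.
Qed.

Variable xi : 'Hom(Sd, K^o).

(** The form whose radical is the stabiliser of [xi] in the semidirect product; [form1] carries the
    brackets of [g] lost in the contraction. *)
Definition form0 (p q : P) : K^o :=
  xi ([lie p.1, q.1], [lie vsval p.1, q.2] - [lie vsval q.1, p.2] + cb p.2 q.2).
Definition form1 (p q : P) : K^o := xi (0, [lie p.2, q.2] - cb p.2 q.2).

(** Inverse of [twist], which combines [phi] with the isomorphism [(s, x) |-> (s, s + x)] from the
    semidirect product of [g_0] with [g] to the direct sum. *)
Let untwist (p : P) : P := (p.1, psi (p.2 - vsval p.1)).
Let twist (p : P) : P := (p.1, vsval p.1 + phi p.2).
Let Xi (p : P) : K^o := xi (untwist p).

Let untwist_linear : linear untwist.
Proof.
move=> a p q; congr pair => /=; rewrite -psi_lin; congr (psi _).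
by rewrite opprD addrACA -scalerBr.
Qed.

Let Xi_linear : linear Xi.
Proof. by move=> a p q; rewrite /Xi untwist_linear; apply: (linearP xi). Qed.

Let untwistK (p : P) : twist (untwist p) = p.
Proof. by case: p => s x; rewrite /twist /untwist /= psiK addrC subrK. Qed.

Let untwist_bracket p q : untwist [lie twist p, twist q] = ([lie p.1, q.1],
  t ^+ m *: ([lie p.2, q.2] - cb p.2 q.2) + ([lie vsval p.1, q.2] - [lie vsval q.1, p.2] + cb p.2 q.2)).
Proof.
case: p q => [s x] [u y]; congr pair => /=; apply: (can_inj phiK); rewrite psiK.
rewrite addrCA [t ^+ m *: _ + _]addrC -[X in phi (X + _)]scale1r phi_lin rescale_bracket scale1r.
have -> : phi ([lie vsval s, y] - [lie vsval u, x]) = [lie vsval s, phi y] - [lie vsval u, phi x].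
  by rewrite /phi linearB /= !rescale_fixed.
rewrite lieDl !lieDr (lieC (phi x) (vsval u)).
by rewrite addrAC [X in X + _]addrAC subrr add0r addrA.
Qed.

Let formE p q : form0 p q + t ^+ m *: form1 p q = Xi [lie twist p, twist q].
Proof.
rewrite /form0 /form1 /Xi untwist_bracket addrC -(linearP xi); congr (xi _).
by congr pair; rewrite /= scaler0 add0r.
Qed.

Lemma form0_bilinear : bilinear_form form0.
Proof.
split=> [p|q] a u v.
  have := linearP xi a [lie (p : Sd), (u : Sd)] [lie (p : Sd), (v : Sd)].
  by rewrite -lie_linearr.
have := linearP xi a [lie (u : Sd), (q : Sd)] [lie (v : Sd), (q : Sd)].
by rewrite -lie_linearl.
Qed.

Lemma form1_bilinear : bilinear_form form1.
Proof.
split=> [p|q] a u v; rewrite /form1 -(linearP xi); congr (xi _); congr pair => /=.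
- by rewrite scaler0 addr0.
- by rewrite contraction_linearr lie_linearr opprD addrACA -scalerBr.
- by rewrite scaler0 addr0.
- by rewrite contraction_linearl lie_linearl opprD addrACA -scalerBr.
Qed.

Lemma form_bilinear : bilinear_form (fun p q => form0 p q + t ^+ m *: form1 p q).
Proof.
have [r0 l0] := form0_bilinear; have [r1 l1] := form1_bilinear.
split=> [p|q] a u v /=; rewrite ?r0 ?r1 ?l0 ?l1.
  by rewrite !scalerDr !scalerA addrACA [a * _]mulrC.
by rewrite !scalerDr !scalerA addrACA [a * _]mulrC.
Qed.

(** [untwist] embeds the stabiliser of the functional [Xi] of the direct sum into this radical. *)
Lemma ind_sum_le_rad :
  (lie_ind P <= \dim (form_rad (fun p q => form0 p q + t ^+ m *: form1 p q)%R))%N.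
Proof.
have le := lie_ind_min (lie_hom Xi_linear).
apply: leq_trans le _; apply: (dim_le_inj untwist_linear).
  have phi0 : phi 0 = 0.
    by rewrite /phi /rescale big1 // => i _; rewrite (gc0 theta m z) scaler0.
  move=> u u0; rewrite -(untwistK u) u0 /twist /=.
  by congr pair; rewrite phi0 addr0.
move=> u /lie_stabP stab; apply/(radP form_bilinear) => q.
by rewrite formE untwistK -(lie_homE Xi_linear) stab.
Qed.

End LowerBound.

Section Main.
Variables (K : closedFieldType) (g : lieAlgType K).
Variables (theta : lieAut g) (m : nat) (z : K).
Hypotheses (zP : m.-primitive_root z) (thetaP : lie_aut_order theta m).
Local Notation L0 := (subvs_of (lsv (fixed_subalg theta))).
Local Notation P := (L0 * g)%type.
Local Notation Sd := (semidirect (ad_action zP thetaP)).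

Lemma ind_tilde_ge : (lie_ind P <= lie_ind Sd)%N.
Proof.
have m_gt0 : (0 < m)%N by case: thetaP.
have [xi <-] := lie_ind_ex Sd.
have cof := cofin_rad (form0_bilinear xi) (form1_bilinear xi) m_gt0.
have [t [t0 le]] := cofin_ex (cofin_and (cofin_neq 0) cof).
apply: leq_trans (ind_sum_le_rad t0 xi) _; apply: leq_trans le _.
by apply: (@dim_le_inj _ _ _ (fun p : P => p : Sd)).
Qed.

End Main.

Theorem mainTheorem3 (K : closedFieldType) (charK0 : [pchar K] =i pred0)
    (g : lieAlgType K) (g_semisimple : lie_semisimple g)
    (theta : lieAut g) (m : nat) (m_ge2 : (2 <= m)%N)
    (theta_order : lie_aut_order theta m)
    (zeta : K) (zeta_prim : m.-primitive_root zeta) :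
  lie_ind (semidirect (ad_action zeta_prim theta_order))
    = lie_ind (subvs_of (fixed_subalg theta) * g)%type
  /\ lie_ind (subvs_of (fixed_subalg theta) * g)%type
    = (lie_rank (subvs_of (fixed_subalg theta)) + lie_rank g)%N.
Proof.
have nd := killing_nondeg charK0 g_semisimple.
have sum := ind_sum charK0 zeta_prim theta_order nd.
have le := ind_tilde_le charK0 zeta_prim theta_order nd.
have ge := ind_tilde_ge zeta_prim theta_order.
split=> //; apply/eqP; rewrite eqn_leq ge andbT.
by rewrite -sum in le.
Qed.
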